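(* The twisted Hilbert space $Z(\mathcal S^2)$ is not asymptotically Hilbertian.
   Context: All Banach spaces are complex; $d_E=d(E,\ell_2^{\dim E})$ is the Banach-Mazur distance for a finite-dimensional $E$. **Derived spaces.** Let $\omega$ be the space of all complex sequences with coordinatewise convergence and $(e_j)$ the unit vectors. Let $X$ be a Banach sequence space and let its dual $X^*$ be regarded as a sequence space through the bilinear pairing $\langle x,y\rangle=\sum_j x_jy_j$; assume $(e_j)$ is an unconditional basis of both $X$ and $X^*$. Let $\mathbb S=\{z\in\mathbb C:0\le \mathrm{Re}\, z\le 1\}$. $\mathcal F_\infty(X,X^* )$ is the space of functions $F:\mathbb S\to\omega$ that are bounded and continuous on $\mathbb S$, analytic in the interior of $\mathbb S$, and such that $t\mapsto F(it)\in X$ and $t\mapsto F(1+it)\in X^*$ are bounded continuous functions, with norm $\|F\|=\max(\sup_t\|F(it)\|_X,\sup_t\|F(1+it)\|_{X^*})$. The interpolation space $(X,X^* )_{1/2}=\{F(1/2):F\in\mathcal F_\infty(X,X^* )\}$ carries the quotient norm. When $(X,X^* )_{1/2}=\ell_2$ (with equivalent norms), the derived space $Z(X)$ is the space of pairs $(x,y)\in\omega\times\omega$ for which $\|(x,y)\|_{Z(X)}=\inf\{\|F\|:F\in\mathcal F_\infty(X,X^* ),\ F(1/2)=y,\ F'(1/2)=x\}$ is finite; it is a twisted Hilbert space (it has a subspace isomorphic to $\ell_2$ with quotient isomorphic to $\ell_2$). **The space $\mathcal S^2$.** A finite set $A=\{n_1<\dots<n_k\}\subset\mathbb N$ is admissible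 if $k\le n_1$. $\mathcal S^2$, the 2-convexification of the Schreier space, is the completion of the space $c_{00}$ of finitely supported sequences under $\|x\|_{\mathcal S^2}=\sup_A(\sum_{j\in A}|x_j|^2)^{1/2}$, the supremum over admissible $A$. One has $(\mathcal S^2,(\mathcal S^2)^* )_{1/2}=\ell_2$ with equivalent norms. **Asymptotically Hilbertian.** A space $X$ is asymptotically Hilbertian if there is $C>0$ such that for every $n\in\mathbb N$ there is a finite-codimensional subspace $X_n$ of $X$ so that every $n$-dimensional subspace $E$ of $X_n$ satisfies $d_E\le C$. *)

(* Defs.v *)
From HB Require Import structures.
From mathcomp Require Import all_boot all_order all_algebra finmap.
From mathcomp Require Import all_classical all_reals all_analysis.
From mathcomp Require Import complex.

Set Implicit Arguments.
Unset Strict Implicit.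
Unset Printing Implicit Defensive.

Import Order.TTheory GRing.Theory Num.Theory.
Import numFieldNormedType.Exports.

Local Open Scope classical_set_scope.
Local Open Scope ring_scope.
Local Open Scope complex_scope.

Section Sequences.
Variable R : realType.

(* R[i]^o is the complex field with its usual topology, as a normed space over
   itself.  The library norm `|z| on it is R[i]-valued; cmod is the modulus as
   an element of R.  omega is used with coordinatewise notions only. *)
Definition cmod (z : R[i]) : R := complex.Re `|z|.
Definition omega := nat -> R[i]^o.

(* The norm is only meaningful on the carrier. *)
Record seqspace := SeqSpace { car : set omega ; nrm : omega -> \bar R }.

Definition pairing_terms (x y : omega) : omega := fun j => x j * y j.

Definition dual_nrm (X : seqspace) (y : omega) : \bar R :=
  ereal_sup [set (cmod (limn (series (pairing_terms x y))))%:E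
            | x in [set x | car X x /\ (nrm X x <= 1)%E]].

Definition dual (X : seqspace) : seqspace := {|
  car := [set y | (forall x, car X x -> cvgn (series (pairing_terms x y)))
                  /\ (dual_nrm X y < +oo)%E] ;
  nrm := dual_nrm X |}.

(* Sequences are indexed from 0 here: index j is coordinate j + 1 of the usual
   indexing by 1, 2, 3, ..., so that #|A| <= min A becomes #|A| <= (min A) + 1. *)
Definition admissible (A : {fset nat}) : Prop :=
  forall j, j \in A -> (#|` A| <= j.+1)%N.

Definition S2_nrm (x : omega) : \bar R :=
  ereal_sup [set (Num.sqrt (\sum_(j <- A) cmod (x j) ^+ 2))%:E
            | A in [set A : {fset nat} | admissible A]].

Definition c00 : set omega :=
  [set x | exists n : nat, forall j, (n <= j)%N -> x j = 0].

(* The completion of c00, realized inside omega: S2_nrm dominates every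
   coordinate and is complete on {x | S2_nrm x < +oo}, so the completion is the
   closure of c00 there, and its norm is S2_nrm. *)
Definition S2 : seqspace := {|
  car := [set x | forall e : R, 0 < e ->
                  exists2 y, c00 y & (S2_nrm (x - y)%R < e%:E)%E] ;
  nrm := S2_nrm |}.

Definition strip : set R[i]^o := [set z : R[i]^o | 0 <= complex.Re z <= 1].

Definition analytic_at (f : R[i]^o -> R[i]^o) (a : R[i]^o) : Prop :=
  exists c : omega, \forall z \near a,
    series (fun n => c n * (z - a) ^+ n : R[i]^o) @ \oo --> f z.

Definition edge_nrm (X : seqspace) (a : R) (F : R[i]^o -> omega) : \bar R :=
  ereal_sup [set nrm X (F (a +i* t)) | t in [set: R]].

(* F is defined on all of R[i], but only its restriction to the strip is
   constrained.  Boundedness, continuity and analyticity of an omega-valued map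
   are those of its coordinates. *)
Record in_calF (X Y : seqspace) (F : R[i]^o -> omega) : Prop := {
  calF_bounded : forall j, [bounded F z j | z in strip] ;
  calF_continuous : forall j, {within strip, continuous (fun z => F z j)} ;
  calF_analytic : forall j z, (strip)° z -> analytic_at (fun z => F z j) z ;
  calF_left : forall t : R, car X (F (0 +i* t)) ;
  calF_left_bounded : (edge_nrm X 0 F < +oo)%E ;
  calF_left_continuous : forall t : R,
    nrm X (F (0 +i* s) - F (0 +i* t)) @[s --> t] --> 0%E ;
  calF_right : forall t : R, car Y (F (1 +i* t)) ;
  calF_right_bounded : (edge_nrm Y 1 F < +oo)%E ;
  calF_right_continuous : forall t : R,
    nrm Y (F (1 +i* s) - F (1 +i* t)) @[s --> t] --> 0%E }.

Definition calF_nrm (X Y : seqspace) (F : R[i]^o -> omega) : \bar R :=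
  maxe (edge_nrm X 0 F) (edge_nrm Y 1 F).

(* The norm of the derived space Z(X), which is the set of pairs where it is
   finite; it is +oo when no F represents the pair. *)
Definition Z_nrm (X : seqspace) (p : omega * omega) : \bar R :=
  ereal_inf [set calF_nrm X (dual X) F | F in
    [set F | [/\ in_calF X (dual X) F,
                 forall j, F (2^-1) j = p.2 j
               & forall j, derive1 (fun z : R[i] => F z j) 2^-1 = p.1 j]]].

End Sequences.

Section AsymptoticallyHilbertian.
Variables (R : realType) (V : lmodType R[i]).

Definition is_subspace (W : set V) : Prop :=
  W 0 /\ forall (a : R[i]) u v, W u -> W v -> W (a *: u + v).

Definition finite_codim (X W : set V) : Prop :=
  exists (m : nat) (s : 'I_m -> V), (forall i, W (s i)) /\
    forall w, W w -> exists2 x, X x &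
      exists a : 'I_m -> R[i], w = x + \sum_i a i *: s i.

Definition l2_nrm (n : nat) (a : 'rV[R[i]]_n) : R :=
  Num.sqrt (\sum_i cmod (a 0 i) ^+ 2).

Definition lin_param (n : nat) (E : set V) (T : {linear 'rV[R[i]]_n -> V}) :=
  injective T /\ range T = E.

Definition has_dim (n : nat) (E : set V) : Prop :=
  exists T : {linear 'rV[R[i]]_n -> V}, lin_param E T.

Definition op_nrm (N : V -> \bar R) (n : nat) (T : 'rV[R[i]]_n -> V) : \bar R :=
  ereal_sup [set N (T a) | a in [set a | l2_nrm a <= 1]].

Definition op_inv_nrm (N : V -> \bar R) (n : nat) (T : 'rV[R[i]]_n -> V)
    : \bar R :=
  ereal_sup [set (l2_nrm a)%:E | a in [set a | (N (T a) <= 1)%E]].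

(* The Banach-Mazur distance of (E, N), with dim E = n, to l_2^n; the infimum
   runs over the isomorphisms from l_2^n onto E. *)
Definition BM_dist_l2 (N : V -> \bar R) (n : nat) (E : set V) : \bar R :=
  ereal_inf [set (op_nrm N T * op_inv_nrm N T)%E
            | T in [set T : {linear 'rV[R[i]]_n -> V} | lin_param E T]].

(* The normed space under consideration is {v | N v < +oo} with norm N. *)
Definition asymptotically_hilbertian (N : V -> \bar R) : Prop :=
  exists2 C : R, 0 < C & forall n : nat,
    exists X : set V,
      [/\ is_subspace X, X `<=` [set v | (N v < +oo)%E],
          finite_codim X [set v | (N v < +oo)%E]
        & forall E : set V, E `<=` X -> has_dim n E ->
            (BM_dist_l2 N n E <= C%:E)%E].

End AsymptoticallyHilbertian.

(* Main.v *)
Require Import Defs.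
From HB Require Import structures.
From mathcomp Require Import all_boot all_order all_algebra finmap.
From mathcomp Require Import all_classical all_reals all_analysis.
From mathcomp Require Import complex ring lra zify.

(** The obstruction is the logarithm in the Kalton-Peck twisted sum, seen as a
    failure of type 2.

    On an interval of indices from M to 2M, the norms of S2 and of its dual both
    agree with the Hilbert norm. Hence a unit vector w of l_2 supported there gives
    a pair (0, w) of norm at most 1 in the derived space, represented by a constant
    function (Z_nrm_block_le1). A subspace X of codimension m contains such pairs
    on every interval longer than m, and even pairs with w as flat as desired
    (subspace_spread_sum). So one finds in X vectors (0, w k), k < n, on successive
    intervals, each so flat that S2 sees the w k like the unit vectors of
    l_infty^n (subspace_spread_blocks, admissible_sum_le).

    Let y be a sum of the w k with unimodular coefficients and let F be any
    function with F(1/2) = y and F'(1/2) = 0, of norm L. Then f = <F, conj y> is at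
    most n L on the left edge of the strip and 2 L on the right edge, f(1/2) = n
    and f'(1/2) = 0. The function g(z) = f(z) n^(z - 1/2) is at most 2 L sqrt n on
    both edges and g'(1/2) = n ln n, so Cauchy's estimate yields
    L >= const * sqrt n * ln n (Z_nrm_signed_sum_ge). Thus all signed sums of n
    vectors of norm at most 1 have norm at least const * sqrt n * ln n, whereas in
    l_2^n some signed sum of n unit vectors has norm at most sqrt n: the span of
    the (0, w k) is at distance at least const * ln n from l_2^n
    (BM_dist_block_map_ge).

    The complex analysis is reduced to one elementary maximum principle
    (maximum_principle), valid for functions whose discrete four-point Laplacian is
    o(r^2). This condition follows from local polynomial approximation of order 3
    (a jet), which passes from power series to products and difference quotients.
    The exponential n^(z - 1/2) is replaced by a power of a polynomial of degree
    one (expn_approx), and Cauchy's estimate by the maximum principle for the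
    difference quotient of g at 1/2 (strip_derivative_bound). *)

Set Implicit Arguments.
Unset Strict Implicit.
Unset Printing Implicit Defensive.

Import Order.TTheory GRing.Theory Num.Theory.
Import numFieldNormedType.Exports.

Local Open Scope classical_set_scope.
Local Open Scope ring_scope.
Local Open Scope complex_scope.

(** * The complex modulus as a real number *)

Section Modulus.
Variable R : realType.
Local Notation C := R[i].
Implicit Types (z w : C) (r : R).

Lemma norm_cmod z : `|z| = (cmod z)%:C.
Proof. by rewrite /cmod normc_def. Qed.

Lemma cmodE z : cmod z = Num.sqrt (complex.Re z ^+ 2 + complex.Im z ^+ 2).
Proof. by rewrite /cmod normc_def. Qed.

Lemma cmod_ge0 z : 0 <= cmod z.
Proof. by rewrite cmodE sqrtr_ge0. Qed.

Lemma sqr_cmod z : cmod z ^+ 2 = complex.Re z ^+ 2 + complex.Im z ^+ 2.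
Proof. by rewrite cmodE sqr_sqrtr // addr_ge0 // sqr_ge0. Qed.

Lemma cmod_real r : cmod r%:C = `|r|.
Proof. by rewrite cmodE /= expr0n addr0 sqrtr_sqr. Qed.

Lemma cmod0 : cmod (0 : C) = 0.
Proof. by rewrite cmodE /= expr0n addr0 sqrtr0. Qed.

Lemma cmod1 : cmod (1 : C) = 1.
Proof. by rewrite cmodE /= expr0n addr0 expr1n sqrtr1. Qed.

Lemma cmodN z : cmod (- z) = cmod z.
Proof. by rewrite /cmod normrN. Qed.

Lemma cmodM z w : cmod (z * w) = cmod z * cmod w.
Proof. by apply: complexI; rewrite rmorphM /= -!norm_cmod normrM. Qed.

Lemma cmodX z n : cmod (z ^+ n) = cmod z ^+ n.
Proof. by elim: n => [|n IH]; rewrite ?expr0 ?cmod1 // !exprS cmodM IH. Qed.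

Lemma cmodV z : cmod z^-1 = (cmod z)^-1.
Proof. by apply: complexI; rewrite fmorphV /= -!norm_cmod normfV. Qed.

Lemma cmodJ z : cmod (z^*)%C = cmod z.
Proof. by apply: complexI; rewrite -!norm_cmod normcJ. Qed.

Lemma cmodD z w : cmod (z + w) <= cmod z + cmod w.
Proof. by rewrite -lecR rmorphD /= -!norm_cmod ler_normD. Qed.

Lemma cmodB z w : cmod (z - w) <= cmod z + cmod w.
Proof. by rewrite -[cmod w]cmodN cmodD. Qed.

Lemma cmod_distC z w : cmod (z - w) = cmod (w - z).
Proof. by rewrite -cmodN opprB. Qed.

Lemma cmod_eq0 z : (cmod z == 0) = (z == 0).
Proof. by rewrite -(inj_eq (@complexI R)) -norm_cmod normr_eq0. Qed.

Lemma cmod_gt0 z : (0 < cmod z) = (z != 0).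
Proof. by rewrite lt_def cmod_ge0 andbT cmod_eq0. Qed.

Lemma cmod_sum I (s : seq I) (P : pred I) (F : I -> C) :
  cmod (\sum_(i <- s | P i) F i) <= \sum_(i <- s | P i) cmod (F i).
Proof.
elim/big_rec2: _ => [|i x y _ h]; first by rewrite cmod0.
by apply: le_trans (cmodD _ _) _; rewrite lerD2l.
Qed.

Lemma ler_Re_cmod z : `|complex.Re z| <= cmod z.
Proof.
rewrite -[leLHS]sqrtr_sqr cmodE ler_wsqrtr // lerDl; exact: sqr_ge0.
Qed.

Lemma ler_Im_cmod z : `|complex.Im z| <= cmod z.
Proof.
rewrite -[leLHS]sqrtr_sqr cmodE ler_wsqrtr // lerDr; exact: sqr_ge0.
Qed.

Lemma ler_cmod_ReIm z : cmod z <= `|complex.Re z| + `|complex.Im z|.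
Proof.
rewrite -[leRHS]ger0_norm ?addr_ge0 // -sqrtr_sqr cmodE ler_wsqrtr //.
by rewrite sqrrD !real_normK ?num_real // lerD2r lerDl mulrn_wge0 // mulr_ge0.
Qed.

Lemma cmod_mulJ z : z * (z^*)%C = (cmod z ^+ 2)%:C.
Proof. by rewrite -sqr_normc norm_cmod rmorphXn. Qed.

Lemma ler_dist_cmod z w : `|cmod z - cmod w| <= cmod (z - w).
Proof.
have h1 := cmodD (z - w) w; have h2 := cmodD (w - z) z.
rewrite !subrK (cmod_distC w) in h1 h2.
by rewrite ler_norml; apply/andP; split; lra.
Qed.

Lemma near_cmod (a : C^o) (P : C^o -> Prop) :
  (\forall z \near a, P z) <->
  exists2 d : R, 0 < d & forall z : C, cmod (z - a) < d -> P z.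
Proof.
split.
  move=> /nbhs_normP[/= e e0 h].
  have [ei er] : complex.Im e = 0 /\ 0 < complex.Re e.
    by move: e0; rewrite ltcE /= => /andP[/eqP-> ->].
  exists (complex.Re e) => // z hz; apply: h => /=.
  by rewrite norm_cmod cmod_distC ltcE /= ei eqxx.
move=> [d d0 h]; apply/nbhs_normP; exists d%:C => /=.
  by rewrite ltcR.
by move=> z /=; rewrite norm_cmod ltcR cmod_distC; exact: h.
Qed.

Lemma cvg_cmod {T : Type} {F : set_system T} {FF : Filter F}
    (f : T -> C^o) (l : C^o) :
  f @ F --> l <-> forall e : R, 0 < e -> \forall x \near F, cmod (f x - l) < e.
Proof.
split.
  move=> /cvgrPdist_lt h e e0.
  have := h e%:C; rewrite ltcR => /(_ e0); apply: filterS => x.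
  by rewrite norm_cmod ltcR cmod_distC.
move=> h; apply/cvgrPdist_lt => e e0.
have [ei er] : complex.Im e = 0 /\ 0 < complex.Re e.
  by move: e0; rewrite ltcE /= => /andP[/eqP-> ->].
apply: filterS (h _ er) => x.
by rewrite norm_cmod ltcE /= ei eqxx cmod_distC.
Qed.

Lemma bounded_cmod {T : Type} (A : set T) (f : T -> C^o) :
  [bounded f x | x in A] <-> exists B : R, forall x, A x -> cmod (f x) <= B.
Proof.
split.
  move=> [M [Mr h]]; exists (complex.Re M + 1) => z Az.
  have MM : M < (complex.Re M + 1)%:C.
    rewrite -[X in X < _](RRe_real Mr) ltcR; lra.
  by have := h _ MM z Az; rewrite /= norm_cmod lecR.
move=> [B h]; exists B%:C; split.
  by apply/complex_realP; exists B.
move=> M BM z Az /=; apply: le_trans (ltW BM).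
by rewrite norm_cmod lecR; exact: h.
Qed.

End Modulus.

(** * A maximum principle on rectangles *)

Section MaximumPrinciple.
Variable R : realType.
Local Notation C := R[i].
Implicit Types (z w : C) (r T : R) (h : C^o -> C^o).

Definition box T : set C^o :=
  [set z : C^o | 0 <= complex.Re z <= 1 /\ `|complex.Im z| <= T].

Definition box_boundary T : set C^o :=
  [set z : C^o | box T z /\
    [\/ complex.Re z = 0, complex.Re z = 1 | `|complex.Im z| = T]].

(** Up to the factor r ^ 2, a discrete Laplacian: it annihilates the constants
    and the first two powers of the increment, so that it is of order r ^ 3 where h
    has a second-order expansion with remainder of order 3. *)
Definition lap4 h z r : C :=
  h (z + r%:C) + h (z - r%:C) + h (z + 0 +i* r) + h (z - 0 +i* r) - 4 * h z.

(** All that the maximum principle needs to know about an analytic function.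
    It follows from a second-order expansion with remainder of order 3. *)
Definition harmonic_at h z := forall e : R, 0 < e ->
  exists2 d : R, 0 < d & forall r, 0 < r < d -> cmod (lap4 h z r) <= e * r ^+ 2.

(** Sum over the four neighbours the inequality
    2 Re (conj (h z) * u) <= |h z| ^ 2 + |u| ^ 2: its left-hand side is linear in
    u, so the sum only involves h z and the discrete Laplacian. *)
Lemma sqr_cmod_submean h z r :
  4 * cmod (h z) ^+ 2 <=
    cmod (h (z + r%:C)) ^+ 2 + cmod (h (z - r%:C)) ^+ 2
    + cmod (h (z + 0 +i* r)) ^+ 2 + cmod (h (z - 0 +i* r)) ^+ 2
    + 2 * cmod (h z) * cmod (lap4 h z r).
Proof.
have /ler_normlP[] := ler_Re_cmod ((h z)^*%C * lap4 h z r).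
rewrite cmodM cmodJ !sqr_cmod /lap4.
case: (h z) => a b; case: (h _) => x1 y1; case: (h _) => x2 y2.
case: (h _) => x3 y3; case: (h _) => x4 y4.
set m := cmod _ * cmod _; rewrite -mulrA -/m; move: m => m; simpl.
move=> h1 _.
have := sqr_ge0 (x1 - a); have := sqr_ge0 (x2 - a).
have := sqr_ge0 (x3 - a); have := sqr_ge0 (x4 - a).
have := sqr_ge0 (y1 - b); have := sqr_ge0 (y2 - b).
have := sqr_ge0 (y3 - b); have := sqr_ge0 (y4 - b).
by move: h1; rewrite !expr2; lra.
Qed.

Lemma continuous_box_compose T (h : C^o -> C^o) (eta : R) :
  {within box T, continuous h} ->
  {within `[0, 1]%classic `*` `[- T, T]%classic,
    continuous (fun p : R * R => cmod (h (p.1 +i* p.2)) ^+ 2 + eta * p.1 ^+ 2)}.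
Proof.
move=> /subspace_continuousP hc; apply/subspace_continuousP => -[x y] /= [xI yI].
have bxy : box T (x +i* y).
  by move: xI yI; rewrite /box /= !in_itv /= ler_norml => -> ->.
have fstc : p.1 @[p --> within (`[0, 1]%classic `*` `[- T, T]%classic)
    (nbhs (x, y))] --> x.
  by apply: cvg_within_filter; exact: cvg_fst.
apply: cvgD; last first.
  by apply: cvgM; [exact: cvg_cst | rewrite expr2; apply: cvgM].
suff cc : cmod (h (p.1 +i* p.2)) @[p --> within (`[0, 1]%classic `*` `[- T, T]%classic)
     (nbhs (x, y))] --> cmod (h (x +i* y)) by rewrite expr2; apply: cvgM.
apply/cvgrPdist_lt => e e0.
have /cvg_cmod/(_ _ e0) := hc _ bxy.
rewrite near_withinE => /near_cmod[d d0 hd].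
have d20 : 0 < d / 2 by rewrite divr_gt0.
have n1 : \forall p \near (x, y), `|x - p.1| < d / 2.
  have : p.1 @[p --> nbhs (x, y)] --> x by exact: cvg_fst.
  by move=> /cvgrPdist_lt; apply.
have n2 : \forall p \near (x, y), `|y - p.2| < d / 2.
  have : p.2 @[p --> nbhs (x, y)] --> y by exact: cvg_snd.
  by move=> /cvgrPdist_lt; apply.
rewrite near_withinE; near=> p => -[pI1 pI2].
have bp : box T (p.1 +i* p.2).
  by move: pI1 pI2; rewrite /box /= !in_itv /= ler_norml => -> ->.
have close : cmod ((p.1 +i* p.2) - (x +i* y)) < d.
  apply: le_lt_trans (ler_cmod_ReIm _) _; rewrite /= distrC (distrC _ y).
  by rewrite [ltRHS]splitr ltrD //; near: p.
apply: le_lt_trans (hd _ close bp).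
by rewrite distrC ler_dist_cmod.
Unshelve. all: by end_near.
Qed.

(** A continuous function attains the maximum of |h| ^ 2 + eta (Re z) ^ 2 on
    the compact box; the sub-mean-value inequality excludes interior points. *)
Lemma maximum_principle T h (K : R) : 0 < T -> 0 <= K ->
  {within box T, continuous h} ->
  (forall z, 0 < complex.Re z < 1 -> `|complex.Im z| < T -> harmonic_at h z) ->
  (forall z, box_boundary T z -> cmod (h z) <= K) ->
  forall z, box T z -> cmod (h z) <= K.
Proof.
move=> T0 K0 hc hh hb.
(* Adding eta times the subharmonic function (Re z)^2, which is at most 1 on
   the box, makes the four-point inequality strict at interior points. *)
suff main (eta : R) : 0 < eta ->
    forall z, box T z -> cmod (h z) ^+ 2 <= K ^+ 2 + eta.
  move=> z bz; rewrite -(ler_pXn2r (n := 2)) ?nnegrE ?cmod_ge0 //.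
  by apply/ler_addgt0Pr => e e0; exact: main.
move=> eta0 z0 bz0.
pose u (p : R * R) := cmod (h (p.1 +i* p.2)) ^+ 2 + eta * p.1 ^+ 2.
pose A := `[0 : R, 1]%classic `*` `[- T, T]%classic.
have boxA (z : C^o) : box T z <-> A (complex.Re z, complex.Im z).
  by rewrite /A /box /= !in_itv /= ler_norml.
have cA : compact A by apply: compact_setX; exact: segment_compact.
have A0 : A !=set0 by exists (complex.Re z0, complex.Im z0); exact/boxA.
have [[x y]] := compact_EVT_max A0 cA (continuous_box_compose (eta := eta) hc).
rewrite inE => Axy umax.
have {}umax (z : C^o) : box T z -> u (complex.Re z, complex.Im z) <= u (x, y).
  by move=> /boxA bz; apply: umax; rewrite inE.
have uE (z : C^o) : u (complex.Re z, complex.Im z) = cmod (h z) ^+ 2 + eta * complex.Re z ^+ 2.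
  by rewrite /u /=; case: (z).
set m : C^o := x +i* y.
have bm : box T m by exact/boxA.
suff mb : box_boundary T m.
  have := umax _ bz0; rewrite uE -[(x, y)]/(complex.Re m, complex.Im m) uE.
  have : cmod (h m) ^+ 2 <= K ^+ 2 by rewrite ler_pXn2r ?nnegrE ?cmod_ge0 // hb.
  have : complex.Re m ^+ 2 <= 1.
    by case: bm => /andP[? ?] _; rewrite expr_le1.
  have : 0 <= complex.Re z0 ^+ 2 by exact: sqr_ge0.
  nra.
split=> //.
have [x0|xn0] := eqVneq x 0; first exact: Or31.
have [x1|xn1] := eqVneq x 1; first exact: Or32.
have [yT|ynT] := eqVneq `|y| T; first exact: Or33.
exfalso.
have xI : 0 < x < 1.
  by case: bm => /andP[/= x0 x1] _; rewrite !lt_neqAle x0 x1 xn1 eq_sym xn0.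
have yI : `|y| < T.
  by case: bm => /= _ yT; rewrite lt_neqAle yT ynT.
(* At an interior maximum m, the four neighbours m + r, m - r, m + ir, m - ir
   gain 2 * eta * r ^ 2 from the perturbation; the error of the discrete
   Laplacian is made smaller than eta * r ^ 2. *)
pose M := 2 * cmod (h m) + 1.
have M0 : 0 < M by rewrite /M; have := cmod_ge0 (h m); lra.
have e0 : 0 < eta / M by rewrite divr_gt0.
have [d d0 hd] := hh m xI yI _ e0.
have [r [r0 rd rx rx1 rT]] : exists r, [/\ 0 < r, r < d, r < x, r < 1 - x & r < T - `|y|].
  pose r := Num.min (Num.min d x) (Num.min (1 - x) (T - `|y|)) / 2.
  have q0 : 0 < Num.min (Num.min d x) (Num.min (1 - x) (T - `|y|)).
    by case/andP: xI => ? ?; rewrite !lt_min d0 !subr_gt0; apply/andP; split; apply/andP; split.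
  exists r; have : r < Num.min (Num.min d x) (Num.min (1 - x) (T - `|y|)).
    by rewrite /r ltr_pdivrMr // ltr_pMr // ltr1n.
  by rewrite !lt_min => /andP[/andP[-> ->] /andP[-> ->]]; split=> //; rewrite divr_gt0.
have lapm := hd r; rewrite r0 rd in lapm; have {}lapm := lapm isT.
have sub := sqr_cmod_submean h m r.
have b1 : box T (m + r%:C).
  by rewrite /box /= addr0; split; [apply/andP; split; lra | exact: ltW].
have b2 : box T (m - r%:C).
  by rewrite /box /= subr0; split; [apply/andP; split; lra | exact: ltW].
have b3 : box T (m + 0 +i* r).
  rewrite /box /= addr0; split; first by apply/andP; split; lra.
  by apply: le_trans (ler_normD _ _) _; rewrite (gtr0_norm r0); lra.
have b4 : box T (m - 0 +i* r).
  rewrite /box /= subr0; split; first by apply/andP; split; lra.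
  by apply: le_trans (ler_normB _ _) _; rewrite (gtr0_norm r0); lra.
have := umax _ b1; have := umax _ b2; have := umax _ b3; have := umax _ b4.
rewrite !uE -[(x, y)]/(complex.Re m, complex.Im m) uE /= !(addr0, subr0).
move: sub.
have lap2 : 2 * cmod (h m) * cmod (lap4 h m r) < eta * r ^+ 2.
  have lt1 : 2 * cmod (h m) * (eta / M) < eta.
    by rewrite mulrA ltr_pdivrMr // mulrC ltr_pM2l // /M ltrDl.
  apply: le_lt_trans (_ : 2 * cmod (h m) * (eta / M * r ^+ 2) < _).
    by rewrite ler_wpM2l // mulr_ge0 ?cmod_ge0.
  by rewrite mulrA ltr_pM2r ?exprn_gt0.
move: lap2; set q := 2 * cmod (h m) * _ => lap2.
have r20 : 0 < eta * r ^+ 2 by rewrite mulr_gt0 ?exprn_gt0.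
lra.
Qed.

End MaximumPrinciple.

(** * Local polynomial approximation *)

Section Jets.
Variable R : realType.
Local Notation C := R[i].
Implicit Types (a b z w : C) (f g : C^o -> C^o) (p q : {poly C}).

(** Local approximation by a polynomial up to order k. Unlike convergent power
    series, jets pass to products and quotients by short computations, and an
    order of 3 is enough to be harmonic in the above sense. *)
Definition jet (k : nat) f a p := exists K : R, exists2 d : R, 0 < d &
  forall w, cmod w < d -> cmod (f (a + w) - p.[w]) <= K * cmod w ^+ k.

Lemma poly_bounded_unit_disc p :
  exists2 M : R, 0 <= M & forall w, cmod w <= 1 -> cmod p.[w] <= M.
Proof.
elim/poly_ind: p => [|p c [M M0 hM]].
  by exists 0 => // w _; rewrite horner0 cmod0.
exists (M + cmod c); first by rewrite addr_ge0 ?cmod_ge0.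
move=> w w1; rewrite !hornerE; apply: le_trans (cmodD _ _) _.
rewrite lerD2r cmodM -[leRHS]mulr1.
by apply: ler_pM; rewrite ?cmod_ge0 ?hM.
Qed.

Lemma jet_bound k f a p : jet k f a p ->
  exists K d : R, [/\ 0 <= K, 0 < d, d <= 1 &
    forall w, cmod w < d -> cmod (f (a + w) - p.[w]) <= K * cmod w ^+ k].
Proof.
move=> [K [d d0 h]]; exists `|K|, (Num.min d 1); split => //.
- by rewrite lt_min d0 ltr01.
- by rewrite ge_min lexx orbT.
move=> w; rewrite lt_min => /andP[wd _]; apply: le_trans (h w wd) _.
by rewrite ler_wpM2r ?exprn_ge0 ?cmod_ge0 ?ler_norm.
Qed.

Lemma jet_base k f a p : (0 < k)%N -> jet k f a p -> f a = p`_0.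
Proof.
move=> k0 /jet_bound[K [d [_ d0 _ /(_ 0)]]].
rewrite cmod0 addr0 => /(_ d0).
rewrite expr0n gtn_eqF // mulr0 horner_coef0 => h0; apply/eqP.
by rewrite -subr_eq0 -cmod_eq0 eq_le cmod_ge0 h0.
Qed.

Lemma poly_split0 p : exists q, p = q * 'X + (p`_0)%:P.
Proof.
elim/poly_ind: p => [|q c _]; first by exists 0; rewrite mul0r coef0 add0r.
by exists q; rewrite coefD coefMX coefC /= add0r.
Qed.

Lemma jet_poly k f a p : (forall w, f (a + w) = p.[w]) -> jet k f a p.
Proof.
move=> h; exists 0; exists 1 => // w _.
by rewrite h subrr cmod0 mul0r.
Qed.

Lemma jetM k f g a p q : jet k f a p -> jet k g a q ->
  jet k (fun z => f z * g z) a (p * q).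
Proof.
move=> /jet_bound[K1 [d1 [K10 d10 d11 h1]]] /jet_bound[K2 [d2 [K20 d20 d21 h2]]].
have [M1 M10 hM1] := poly_bounded_unit_disc p.
have [M2 M20 hM2] := poly_bounded_unit_disc q.
exists (K1 * (M2 + K2) + M1 * K2); exists (Num.min d1 d2).
  by rewrite lt_min d10 d20.
move=> w; rewrite lt_min => /andP[wd1 wd2].
have w1 : cmod w <= 1 by apply: ltW; apply: lt_le_trans wd1 _.
have e0 : 0 <= cmod w ^+ k by rewrite exprn_ge0 ?cmod_ge0.
have e1 : cmod w ^+ k <= 1 by rewrite exprn_ile1 ?cmod_ge0.
have {}h1 := h1 w wd1; have {}h2 := h2 w wd2.
have {}hM1 := hM1 w w1; have {}hM2 := hM2 w w1.
rewrite hornerM.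
have -> : f (a + w) * g (a + w) - p.[w] * q.[w] =
  (f (a + w) - p.[w]) * (q.[w] + (g (a + w) - q.[w])) + p.[w] * (g (a + w) - q.[w]).
  by ring.
apply: le_trans (cmodD _ _) _; rewrite [leRHS]mulrDl; apply: lerD; rewrite cmodM.
  rewrite mulrAC; apply: ler_pM; rewrite ?cmod_ge0 //.
  apply: le_trans (cmodD _ _) _; apply: lerD => //.
  by apply: le_trans h2 _; rewrite -[leRHS]mulr1 ler_wpM2l.
by rewrite -mulrA; apply: ler_pM; rewrite ?cmod_ge0.
Qed.

(** Truncation of the geometric series of 1 / (c + w) at c = a - b. *)
Lemma jet_inv a b : a != b -> exists p, jet 3 (fun z => (z - b)^-1) a p.
Proof.
move=> ab; pose c := a - b; have c0 : c != 0 by rewrite subr_eq0.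
exists (c^-1%:P - (c ^- 2) *: 'X + (c ^- 3) *: 'X^2).
exists (2 / cmod c ^+ 4); exists (cmod c / 2).
  by rewrite divr_gt0 ?cmod_gt0.
move=> w wc.
have -> : (c^-1%:P - (c ^- 2) *: 'X + (c ^- 3) *: 'X^2).[w] =
    c^-1 - c ^- 2 * w + c ^- 3 * w ^+ 2 by rewrite !hornerE /=; ring.
have cw0 : c + w != 0.
  apply: contraTneq wc => /eqP; rewrite addr_eq0 => /eqP ->.
  rewrite cmodN -leNgt; have := cmod_ge0 w; lra.
have -> : a + w - b = c + w by rewrite /c; ring.
have cl : cmod c / 2 <= cmod (c + w).
  have := cmodD (c + w) (- w); rewrite addrK cmodN; lra.
have cc0 : 0 < cmod c by rewrite cmod_gt0.
rewrite [X in cmod X](_ : _ = - w ^+ 3 / (c ^+ 3 * (c + w))); last first.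
  by field; rewrite c0 cw0.
rewrite cmodM cmodN cmodV cmodM !cmodX mulrC.
apply: ler_wpM2r; first by rewrite exprn_ge0 ?cmod_ge0.
rewrite -[2 / _]invf_div lef_pV2 ?posrE ?mulr_gt0 ?exprn_gt0 ?divr_gt0 ?invr_gt0 ?cmod_gt0 //.
by rewrite exprSr -mulrA ler_wpM2l ?exprn_ge0 ?cmod_ge0.
Qed.

(** The singularity of the difference quotient at a is removable, at the cost
    of one order of approximation. *)
Lemma jet_diff_quotient k g a p : (0 < k)%N -> jet k.+1 g a p ->
  exists q, jet k (fun z => if z == a then p`_1 else (g z - g a) / (z - a)) a q.
Proof.
move=> k0 jg; have p0 : g a = p`_0 by exact: jet_base jg.
case/jet_bound: jg => K [d [K0 d0 d1 h]].
have [q pq] := poly_split0 p.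
have q1 : p`_1 = q.[0].
  by rewrite pq coefD coefMX coefC /= addr0 horner_coef0.
exists q, K; exists d => // w wd.
have [->|w0] := eqVneq w 0.
  by rewrite addr0 eqxx q1 subrr cmod0 mulr_ge0 ?exprn_ge0.
rewrite -subr_eq0 addrAC subrr add0r (negPf w0).
have {}h := h w wd.
have -> : (g (a + w) - g a) / w - q.[w] = (g (a + w) - p.[w]) / w.
  by rewrite pq !hornerE p0; field.
by rewrite cmodM cmodV ler_pdivrMr ?cmod_gt0 // -mulrA -exprSr.
Qed.

(** The four increments sum to zero and so do their squares; only the terms of
    order 3 survive in the discrete Laplacian. *)
Lemma jet_harmonic f a p : jet 3 f a p -> harmonic_at f a.
Proof.
move=> jf; have fa : f a = p`_0 by exact: jet_base jf.
case/jet_bound: jf => K [d [K0 d0 d1 h]].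
have [q pq] : exists q, p = q * 'X^3 + (p`_2 *: 'X^2 + p`_1 *: 'X + (p`_0)%:P).
  exists (drop_poly 3 p); rewrite -[LHS](poly_take_drop 3) addrC; congr (_ + _).
  apply/polyP => i; rewrite coef_take_poly !coefE.
  by case: i => [|[|[|i]]] //=; rewrite ?(mulr0, mulr1, addr0, add0r).
have [M M0 hM] := poly_bounded_unit_disc q.
move=> e e0; pose N := 8 * (K + M + 1).
have N0 : 0 < N by rewrite /N; lra.
exists (Num.min d (e / N)); first by rewrite lt_min d0 divr_gt0.
move=> r /andP[r0]; rewrite lt_min => /andP[rd rN].
have pE w : p.[w] = q.[w] * w ^+ 3 + (p`_2 * w ^+ 2 + p`_1 * w + p`_0).
  by rewrite {1}pq !hornerE /=; ring.
have fw w : cmod w = r -> cmod (f (a + w) -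
    (p`_2 * w ^+ 2 + p`_1 * w + p`_0)) <= (K + M) * r ^+ 3.
  move=> wr; have := h w; rewrite wr => /(_ rd) {}h.
  have w1 : cmod w <= 1 by rewrite wr; lra.
  rewrite [X in cmod X](_ : _ = f (a + w) - p.[w] + q.[w] * w ^+ 3); last first.
    by rewrite pE; ring.
  apply: le_trans (cmodD _ _) _; rewrite [leRHS]mulrDl lerD //.
  by rewrite cmodM cmodX wr ler_wpM2r ?hM // exprn_ge0 // ltW.
have f1 : cmod (r%:C) = r by rewrite cmod_real gtr0_norm.
have f2 : cmod (0 +i* r) = r.
  by rewrite cmodE /= expr0n add0r sqrtr_sqr gtr0_norm.
have [F1 F2] := (fw _ f1, fw (- _) (etrans (cmodN _) f1)).
have [F3 F4] := (fw _ f2, fw (- _) (etrans (cmodN _) f2)).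
have i2 : (0 +i* r) ^+ 2 = - (r%:C) ^+ 2 :> C.
  by apply/eqP; rewrite eq_complex !expr2 /=; apply/andP; split; apply/eqP; ring.
set g := fun w : C => p`_2 * w ^+ 2 + p`_1 * w + p`_0 in F1 F2 F3 F4.
have -> : lap4 f a r = (f (a + r%:C) - g r%:C) + (f (a - r%:C) - g (- r%:C))
   + (f (a + 0 +i* r) - g (0 +i* r)) + (f (a - 0 +i* r) - g (- (0 +i* r))).
  by rewrite /lap4 /g !sqrrN i2 fa; ring.
have tr (x y u v : C) : cmod (x + y + u + v) <= cmod x + cmod y + cmod u + cmod v.
  by do 3 (apply: le_trans (cmodD _ _) _; rewrite lerD2r).
apply: le_trans (tr _ _ _ _) _.
have {}rN : N * r < e by rewrite mulrC -ltr_pdivlMr.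
apply: le_trans (_ : N * r * r ^+ 2 <= _); last first.
  by rewrite ler_wpM2r ?exprn_ge0 ?(ltW r0) // ltW.
have -> : N * r * r ^+ 2 = 4 * ((K + M) * r ^+ 3) + (4 * (K + M) + 8) * r ^+ 3.
  by rewrite /N; ring.
have : 0 <= (4 * (K + M) + 8) * r ^+ 3.
  by rewrite mulr_ge0 ?exprn_ge0 ?(ltW r0) //; lra.
move: F1 F2 F3 F4; rewrite /g; lra.
Qed.

End Jets.

(** * Convergent power series *)

Section PowerSeries.
Variable R : realType.
Local Notation C := R[i].
Implicit Types (a b z w : C) (f g : C^o -> C^o) (c d : omega R).

Definition powser_at f a c :=
  \forall z \near (a : C^o), series (fun n => c n * (z - a) ^+ n : C^o) @ \oo --> f z.

Lemma powser_at_lin k f g a c d : powser_at f a c -> powser_at g a d ->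
  powser_at (fun z => k * f z + g z) a (fun n => k * c n + d n).
Proof.
rewrite /powser_at; apply: filterS2 => z fz gz.
have -> : series (fun n => (k * c n + d n) * (z - a) ^+ n : C^o) =
  (fun n => k * series (fun n => c n * (z - a) ^+ n : C^o) n +
     series (fun n => d n * (z - a) ^+ n : C^o) n).
  apply/funext => n; rewrite /series /= mulr_sumr -big_split /=.
  by apply: eq_bigr => i _; rewrite mulrDl mulrA.
apply: cvgD gz.
exact: cvgMr fz.
Qed.

(** The subtracted term makes the bound inductive. *)
Lemma geometric_tail (t : R) k N : 0 <= t <= 1 / 2 -> (k <= N)%N ->
  \sum_(k <= n < N) t ^+ n <= 2 * t ^+ k - 2 * t ^+ N.
Proof.
move=> /andP[t0 t1]; elim: N => [|N IH].
  by rewrite leqn0 => /eqP ->; rewrite big_geq // subrr.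
rewrite leq_eqVlt => /predU1P[->|]; first by rewrite big_geq // subrr.
rewrite ltnS => kN; rewrite big_nat_recr //=.
have := IH kN; have : 0 <= t ^+ N by exact: exprn_ge0.
rewrite [t ^+ N.+1]exprS; nra.
Qed.

(** The coefficients are bounded by B / rho ^ n for some rho > 0 (the terms of a
    convergent series are bounded), so the tail beyond order k is dominated by a
    geometric series on the disc of radius rho / 2. *)
Lemma powser_jet k f a c : powser_at f a c -> jet k f a (\poly_(i < k) c i).
Proof.
move=> /near_cmod[d d0 h].
pose rho := d / 2; have rho0 : 0 < rho by rewrite divr_gt0.
pose S (w : C) n := \sum_(0 <= i < n) c i * w ^+ i.
have cvS w : cmod w < d -> forall e, 0 < e ->
    exists n0, forall n, (n0 <= n)%N -> cmod (S w n - f (a + w)) < e.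
  move=> wd e e0; have := h (a + w); rewrite addrAC subrr add0r => /(_ wd).
  by move=> /cvg_cmod/(_ _ e0)[n0 _ hn]; exists n0.
have [B hB] : exists B, forall n, cmod (c n) * rho ^+ n <= B.
  have : cvgn (S rho%:C : nat -> C^o).
    apply/cvg_ex; exists (f (a + rho%:C)); have := h (a + rho%:C).
    rewrite addrAC subrr add0r cmod_real gtr0_norm //; apply.
    by rewrite /rho ltr_pdivrMr // ltr_pMr // ltr1n.
  move=> /cvg_seq_bounded/bounded_cmod[B hB]; exists (B + B) => n.
  rewrite -[rho in leLHS]gtr0_norm // -cmod_real -cmodX -cmodM.
  have -> : c n * rho%:C ^+ n = S rho%:C n.+1 - S rho%:C n.
    by rewrite /S big_nat_recr //= addrAC subrr add0r.
  by apply: le_trans (cmodB _ _) _; rewrite lerD // hB.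
have B0 : 0 <= B.
  by apply: le_trans (hB 0%N); rewrite mulr_ge0 ?cmod_ge0.
exists (2 * B / rho ^+ k); exists (rho / 2); first by rewrite divr_gt0.
move=> w wr; have wd : cmod w < d.
  by apply: lt_trans wr _; rewrite /rho; lra.
have -> : (\poly_(i < k) c i).[w] = S w k.
  by rewrite horner_poly /S big_mkord.
apply/ler_addgt0Pr => e e0; have [n0 hn] := cvS w wd e e0.
pose N := maxn n0 k.
have := hn N (leq_maxl _ _); rewrite cmod_distC => {}hn.
have -> : f (a + w) - S w k = (f (a + w) - S w N) + (S w N - S w k) by ring.
apply: le_trans (cmodD _ _) _; rewrite addrC; apply: lerD (ltW hn).
have kN : (k <= N)%N by exact: leq_maxr.
have -> : S w N - S w k = \sum_(k <= i < N) c i * w ^+ i.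
  by rewrite /S (big_cat_nat (n := k)) //= addrAC subrr add0r.
apply: le_trans (cmod_sum _ _ _) _.
pose t := cmod w / rho.
have t01 : 0 <= t <= 1 / 2.
  rewrite divr_ge0 ?cmod_ge0 ?(ltW rho0) //= ler_pdivrMr // mulrAC mul1r.
  exact: ltW.
apply: le_trans (_ : \sum_(k <= i < N) B * t ^+ i <= _).
  apply: ler_sum => i _; rewrite cmodM cmodX /t expr_div_n.
  rewrite mulrA ler_pdivlMr ?exprn_gt0 // mulrAC.
  by rewrite ler_wpM2r ?exprn_ge0 ?cmod_ge0.
rewrite -mulr_sumr; have /(ler_wpM2l B0) := geometric_tail t01 kN.
move/le_trans; apply.
have tk : t ^+ k = cmod w ^+ k / rho ^+ k by rewrite expr_div_n.
have BtN : 0 <= B * t ^+ N.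
  by apply: mulr_ge0 => //; apply: exprn_ge0; case/andP: t01.
by rewrite (mulrAC _ _ (_ ^+ k)) -[_ * cmod w ^+ k / _]mulrA -tk; lra.
Qed.

Lemma powser_derive1 f a c : powser_at f a c ->
  derive1 (fun z : C => f z) a = c 1%N.
Proof.
move=> hf; have fa : f a = c 0%N.
  by rewrite (jet_base (isT : (0 < 1)%N) (powser_jet 1 hf)) coef_poly.
have [K [d [K0 d0 _ h]]] := jet_bound (powser_jet 2 hf).
apply: cvg_lim => //.
apply/(@cvg_cmod R) => e e0; apply/near_cmod.
exists (Num.min d (e / (K + 1))).
  by rewrite lt_min d0 divr_gt0 // ltr_wpDl.
move=> w; rewrite subr0 lt_min => /andP[wd we] w0.
have := h w wd; rewrite horner_poly 2!big_ord_recr big_ord0 /= add0r.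
rewrite mulr1 -fa => hw; rewrite (addrC w).
have -> : w^-1 *: (f (a + w) - f a) - c 1%N =
  (f (a + w) - (f a + c 1%N * w ^+ 1)) / w.
  by rewrite /GRing.scale /=; field.
rewrite cmodM cmodV ltr_pdivrMr ?cmod_gt0 //.
apply: le_lt_trans hw _; rewrite expr2 mulrA.
rewrite ltr_pM2r ?cmod_gt0 //.
have K1 : 0 < K + 1 by lra.
have : cmod w * (K + 1) < e by rewrite -ltr_pdivlMr.
have := cmod_ge0 w; lra.
Qed.

End PowerSeries.

Section JetLimits.
Variable R : realType.
Local Notation C := R[i].
Implicit Types (a b z w : C) (f g : C^o -> C^o) (p q : {poly C}).

Lemma jet_near k f g a p : (\forall z \near (a : C^o), f z = g z) ->
  jet k f a p -> jet k g a p.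
Proof.
move=> /near_cmod[d1 d10 fg] [K [d d0 h]].
exists K, (Num.min d1 d); first by rewrite lt_min d10.
move=> w; rewrite lt_min => /andP[wd1 wd]; rewrite -fg ?h //.
by rewrite addrAC subrr add0r.
Qed.

Lemma jetB_cst k f a p c : jet k f a p -> jet k (fun z => f z - c) a (p - c%:P).
Proof.
move=> [K [d d0 h]]; exists K, d => // w wd; rewrite hornerD hornerN hornerC.
have -> : f (a + w) - c - (p.[w] - c) = f (a + w) - p.[w] by ring.
exact: h.
Qed.

Lemma jet_cvg k f a p : (0 < k)%N -> jet k f a p -> f z @[z --> (a : C^o)] --> f a.
Proof.
move=> k0 jf; have fa := jet_base k0 jf.
case/jet_bound: jf => K [d [K0 d0 d1 h]].
have [q pq] := poly_split0 p.
have [M M0 hM] := poly_bounded_unit_disc q.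
apply/(@cvg_cmod R _ (nbhs (a : C^o)) _) => e e0; apply/near_cmod.
have KM : 0 < K + M + 1 by lra.
exists (Num.min d (e / (K + M + 1))); first by rewrite lt_min d0 divr_gt0.
move=> z; rewrite lt_min => /andP[wd we]; have {h} := h _ wd.
rewrite (addrC a) subrK; set w := z - a in wd we * => h.
have w1 : cmod w <= 1 by apply: ltW; apply: lt_le_trans wd d1.
have -> : f z - f a = (f z - p.[w]) + q.[w] * w.
  by rewrite fa [p in p.[w]]pq !hornerE /=; ring.
apply: le_lt_trans (cmodD _ _) _; rewrite cmodM.
have h2 : cmod w ^+ k <= cmod w.
  by case: k k0 {h} => // k _; rewrite exprS ler_piMr ?cmod_ge0 // exprn_ile1 ?cmod_ge0.
have h3 := ler_wpM2l K0 h2; have h4 := ler_wpM2r (cmod_ge0 w) (hM w w1).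
have : cmod w * (K + M + 1) < e by rewrite -ltr_pdivlMr.
have := cmod_ge0 w; lra.
Qed.

End JetLimits.

(** * A derivative estimate on the strip *)

Section StripBound.
Variable R : realType.
Local Notation C := R[i].
Implicit Types (a z w : C) (f : C^o -> C^o).

Lemma sqr_cmod_1D (mu : R) w :
  cmod (1 + mu%:C * w) ^+ 2 = 1 + 2 * mu * complex.Re w + mu ^+ 2 * cmod w ^+ 2.
Proof.
by case: w => x y; rewrite !sqr_cmod /=; ring.
Qed.

(** Polynomial substitute for exp (lam * (z - 1/2)): its derivative at 1/2 is
    exactly lam, and its modulus on a bounded set is close to that of the
    exponential once N is large. *)
Definition expn_approx (lam : R) (N : nat) (z : C^o) : C^o :=
  (1 + (lam / N%:R)%:C * (z - 2^-1)) ^+ N.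

Lemma half_real : 2^-1 = (2^-1 : R)%:C :> C.
Proof. by rewrite fmorphV rmorph_nat. Qed.

(** |1 + mu w| ^ 2 = 1 + 2 mu Re w + mu ^ 2 |w| ^ 2 is at most the exponential of
    the last two terms; the quadratic one contributes at most 1 after raising to
    the power N, whence the final 1/2. *)
Lemma cmod_expn_approx lam (N : nat) z : (0 < N)%N ->
  lam ^+ 2 * cmod (z - 2^-1) ^+ 2 <= N%:R ->
  cmod (expn_approx lam N z) <= expR (lam * (complex.Re z - 2^-1) + 2^-1).
Proof.
move=> N0 hN; rewrite -(ler_pXn2r (n := 2)) ?nnegrE ?cmod_ge0 ?expR_ge0 //.
have Nr : 0 < N%:R :> R by rewrite ltr0n.
rewrite /expn_approx cmodX -exprM mulnC exprM sqr_cmod_1D.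
have -> : complex.Re (z - 2^-1) = complex.Re z - 2^-1.
  by rewrite half_real; case: (z).
move: hN; set x := complex.Re z - _; set t := cmod _ ^+ 2 => hN.
have t0 : 0 <= t by exact: sqr_ge0.
set mu := lam / _.
have le1 : 1 + 2 * mu * x + mu ^+ 2 * t <= expR (2 * mu * x + mu ^+ 2 * t).
  by rewrite -addrA expR_ge1Dx.
have ge0 : 0 <= 1 + 2 * mu * x + mu ^+ 2 * t.
  have := sqr_ge0 (cmod (1 + mu%:C * (z - 2^-1))).
  suff -> : x = complex.Re (z - 2^-1) by rewrite sqr_cmod_1D.
  by rewrite /x half_real; case: (z).
apply: le_trans (_ : expR (2 * mu * x + mu ^+ 2 * t) ^+ N <= _).
  by rewrite lerXn2r // nnegrE expR_ge0.
rewrite -!expRM_natl ler_expR.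
have -> : N%:R * (2 * mu * x + mu ^+ 2 * t) = 2 * (lam * x) + lam ^+ 2 * t / N%:R.
  by rewrite /mu; field; rewrite gt_eqF.
have : lam ^+ 2 * t / N%:R <= 1 by rewrite ler_pdivrMr // mul1r.
lra.
Qed.

Lemma expn_approx_jet lam N a k : exists p, jet k (expn_approx lam N) a p.
Proof.
pose mu : C := (lam / N%:R)%:C.
exists ((1 + mu *: ('X + (a - 2^-1)%:P)) ^+ N).
apply: jet_poly => w; rewrite /expn_approx !hornerE -/mu.
by congr (_ ^+ _); rewrite /=; ring.
Qed.

Lemma coef01_1DZX (A : comNzRingType) (mu : A) n :
  ((1 + mu *: 'X) ^+ n)`_0 = 1 /\ ((1 + mu *: 'X) ^+ n)`_1 = mu *+ n.
Proof.
elim: n => [|n [IH0 IH1]]; first by rewrite expr0 !coef1.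
rewrite exprS; split; first by rewrite coef0M IH0 !coefE /= mulr0 addr0 mulr1.
rewrite coefM 2!big_ord_recl big_ord0 /= IH0 IH1 !coefE /= mulr0 mulr1 addr0.
by rewrite mulr1 add0r addr0 mul1r mulrSr.
Qed.

Lemma expn_approx_jet_half lam N k : (0 < N)%N -> exists p,
  [/\ jet k (expn_approx lam N) 2^-1 p, p`_0 = 1 & p`_1 = lam%:C].
Proof.
move=> N0; pose mu : C := (lam / N%:R)%:C.
have NC : N%:R != 0 :> R by rewrite pnatr_eq0 -lt0n.
exists ((1 + mu *: 'X) ^+ N); split.
- apply: jet_poly => w; rewrite /expn_approx !hornerE -/mu.
  by congr (_ ^+ _); rewrite /=; ring.
- by have [] := coef01_1DZX mu N.
have [_ ->] := coef01_1DZX mu N; rewrite -mulr_natr /mu -(rmorph_nat (real_complex R)) -rmorphM.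
by rewrite /= divfK.
Qed.

Lemma Re_half_le_dist z : `|complex.Re z - 2^-1| <= cmod (z - 2^-1).
Proof.
apply: le_trans (ler_Re_cmod _); rewrite half_real; by case: z.
Qed.

(** Three lines plus Cauchy's estimate, in one application of the maximum
    principle. Multiplying f by (almost) exp (lam * (z - 1/2)) makes it bounded by
    expR ((lam + 1) / 2) * K on both edges, and gives it the derivative
    lam * f (1/2) at 1/2. That derivative is the value at 1/2 of the difference
    quotient H, which is at most 2 * (expR ((lam + 1) / 2) * K + |f (1/2)|) on the
    edges because these are at distance 1/2 from 1/2, and which is small far away
    on the strip since f is bounded there. *)
Lemma strip_derivative_bound f (lam B K : R) : 0 <= lam ->
  (forall z, strip z -> cmod (f z) <= B) ->
  {within @strip R, continuous f} ->
  (forall z, 0 < complex.Re z < 1 -> exists c, powser_at f z c) ->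
  derive1 (fun z : C => f z) 2^-1 = 0 ->
  (forall t, cmod (f (0 +i* t)) <= expR lam * K) ->
  (forall t, cmod (f (1 +i* t)) <= K) ->
  (lam - 2) * cmod (f 2^-1) <= 2 * expR ((lam + 1) / 2) * K.
Proof.
move=> lam0 fB fc fan df fl fr.
have K0 : 0 <= K by apply: le_trans (fr 0); exact: cmod_ge0.
set A := cmod (f 2^-1); set E := expR ((lam + 1) / 2).
have E0 : 0 < E by exact: expR_gt0.
have [A0|An0] := eqVneq A 0.
  by rewrite A0 mulr0 !mulr_ge0 // ltW.
have A0 : 0 < A by rewrite lt_neqAle eq_sym An0 cmod_ge0.
have Rehalf : complex.Re (2^-1 : C) = 2^-1 by rewrite half_real.
have AB : A <= B by apply: fB; rewrite half_real /strip /=; apply/andP; split; lra.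
(* Height of the box, for which H is at most 2 * A on the horizontal sides. *)
pose T := (B * E + A) / (2 * A) + 1.
have BE0 : 0 <= B * E by rewrite mulr_ge0 ?(ltW E0) //; lra.
have T0 : 0 < T.
  by rewrite /T ltr_wpDl // divr_ge0 //; lra.
pose N := (Num.bound (lam ^+ 2 * (4^-1 + T ^+ 2))).+1.
have NT : lam ^+ 2 * (4^-1 + T ^+ 2) <= N%:R.
  apply: le_trans (ltW (archi_boundP _)) _; last by rewrite ler_nat leqnSn.
  by rewrite mulr_ge0 ?sqr_ge0 // addr_ge0 ?sqr_ge0.
pose P := expn_approx lam N.
have PB z : box T z -> cmod (P z) <= expR (lam * (complex.Re z - 2^-1) + 2^-1).
  move=> [/andP[z0 z1] zT]; apply: cmod_expn_approx => //.
  apply: le_trans NT; apply: ler_wpM2l; first exact: sqr_ge0.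
  rewrite sqr_cmod.
  have -> : complex.Re (z - 2^-1) = complex.Re z - 2^-1.
    by rewrite half_real; case: (z).
  have -> : complex.Im (z - 2^-1) = complex.Im z.
    by rewrite half_real; case: (z) => x y /=; rewrite subr0.
  have : complex.Im z ^+ 2 <= T ^+ 2.
    by rewrite -[leLHS]real_normK ?num_real // lerXn2r // nnegrE // ltW.
  nra.
have [pP [jP pP0 pP1]] := expn_approx_jet_half lam 4 (isT : (0 < N)%N).
have [c hc] : exists c, powser_at f 2^-1 c.
  by apply: fan; rewrite Rehalf; lra.
have c1 : c 1%N = 0 by rewrite -(powser_derive1 hc).
have jf := powser_jet 4 hc.
set pf : {poly C} := \poly_(i < 4) c i in jf.
have pf0 : f 2^-1 = pf`_0 by exact: (jet_base (isT : (0 < 4)%N) jf).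
pose G (z : C^o) : C^o := f z * P z.
have jG : jet 4 G 2^-1 (pf * pP) := jetM jf jP.
have P1 : P 2^-1 = 1 := etrans (jet_base (isT : (0 < 4)%N) jP) pP0.
have G1 : G 2^-1 = f 2^-1 by rewrite /G P1 mulr1.
have dG : (pf * pP)`_1 = f 2^-1 * lam%:C.
  rewrite coefM 2!big_ord_recl big_ord0 /= -pf0 pP0 pP1.
  by rewrite /bump /= coef_poly /= c1 mul0r !addr0.
pose H (z : C^o) : C^o :=
  if z == 2^-1 then (pf * pP)`_1 else (G z - G 2^-1) / (z - 2^-1).
have [pH jH] := jet_diff_quotient (isT : (0 < 3)%N) jG.
rewrite -/H in jH.
have Hnear a : a != 2^-1 -> \forall z \near (a : C^o),
    (G z - G 2^-1) * (z - 2^-1)^-1 = H z.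
  move=> a2; apply/near_cmod; exists (cmod (a - 2^-1)).
    by rewrite cmod_gt0 subr_eq0.
  move=> z hz; rewrite /H ifF //; apply/negP => /eqP z2.
  by move: hz; rewrite z2 cmod_distC ltxx.
have Hharm z : 0 < complex.Re z < 1 -> `|complex.Im z| < T -> harmonic_at H z.
  move=> z01 _; have [->|z2] := eqVneq z 2^-1; first exact: jet_harmonic jH.
  have [d hd] := fan z z01.
  have [p1 j1] := expn_approx_jet lam N z 3.
  have [p2 j2] := jet_inv z2.
  apply: jet_harmonic.
  apply: jet_near (Hnear _ z2) (jetM (jetB_cst (G 2^-1) (jetM (powser_jet 3 hd) j1)) j2).
have boxstrip : box T `<=` @strip R by move=> z [].
have Hcont : {within box T, continuous H}.
  apply/subspace_continuousP => a aT.
  have [->|a2] := eqVneq a 2^-1.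
    by apply: cvg_within_filter; apply: jet_cvg jH.
  have ca : f z @[z --> within (box T) (nbhs (a : C^o))] --> f a.
    have /subspace_continuousP/(_ _ (boxstrip _ aT)) := fc.
    apply: cvg_trans; apply: cvg_app; exact: within_subset.
  have [p1 j1] := expn_approx_jet lam N a 3.
  have [p2 j2] := jet_inv a2.
  have cP : P z @[z --> within (box T) (nbhs (a : C^o))] --> P a.
    by apply: cvg_within_filter; apply: jet_cvg j1.
  have cI : (z - 2^-1)^-1 @[z --> within (box T) (nbhs (a : C^o))] --> (a - 2^-1)^-1.
    by apply: cvg_within_filter; apply: (jet_cvg (isT : (0 < 3)%N) j2).
  have Ha : H a = (G a - G 2^-1) * (a - 2^-1)^-1.
    by rewrite /H (negPf a2).
  have cG : (G z - G 2^-1) * (z - 2^-1)^-1 @[z --> within (box T) (nbhs (a : C^o))]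
      --> H a.
    rewrite Ha; exact: cvgM (cvgB (cvgM ca cP) (cvg_cst (G 2^-1))) cI.
  apply: cvg_trans cG.
  apply: near_eq_cvg; rewrite near_withinE.
  by apply: filterS (Hnear _ a2) => z hz _; exact: hz.
pose M := 2 * (E * K) + 2 * A.
have EK0 : 0 <= E * K by rewrite mulr_ge0 // ltW.
have M0 : 0 <= M by rewrite /M; lra.
have GA z : cmod (G z - G 2^-1) <= cmod (f z) * cmod (P z) + A.
  by rewrite G1 -cmodM; exact: cmodB.
have side z : box T z -> `|complex.Re z - 2^-1| = 2^-1 ->
    cmod (f z) * cmod (P z) <= E * K -> cmod (H z) <= M.
  move=> bz hz hf; have hd := Re_half_le_dist z.
  rewrite hz in hd.
  have d0 : 0 < cmod (z - 2^-1) by apply: lt_le_trans hd; lra.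
  rewrite /H ifF; last by apply/negP; rewrite -subr_eq0 -cmod_eq0 gt_eqF.
  rewrite cmodM cmodV ler_pdivrMr //.
  apply: le_trans (GA z) _; apply: le_trans (_ : E * K + A <= _).
    by rewrite lerD2r.
  have := ler_wpM2l M0 hd; rewrite /M; lra.
have Hbd z : box_boundary T z -> cmod (H z) <= M.
  move=> [bz [z0|z1|zT]].
  - apply: side => //.
      by rewrite z0 sub0r normrN gtr0_norm.
    have := PB _ bz; rewrite z0 => hP.
    have zE : z = 0 +i* complex.Im z by rewrite -z0; case: (z).
    apply: le_trans (_ : expR lam * K * expR (lam * (0 - 2^-1) + 2^-1) <= _).
      by apply: ler_pM; rewrite ?cmod_ge0 // zE.
    rewrite mulrAC -expRD ler_wpM2r // ler_expR; lra.
  - apply: side => //.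
      by rewrite z1 ger0_norm; lra.
    have := PB _ bz; rewrite z1 => hP.
    have zE : z = 1 +i* complex.Im z by rewrite -z1; case: (z).
    apply: le_trans (_ : K * expR (lam * (1 - 2^-1) + 2^-1) <= _).
      by apply: ler_pM; rewrite ?cmod_ge0 // zE.
    rewrite mulrC ler_wpM2r // ler_expR; lra.
  have hd : T <= cmod (z - 2^-1).
    rewrite -zT; apply: le_trans (ler_Im_cmod _).
    by rewrite half_real; case: (z) => x y /=; rewrite subr0.
  have d0 : 0 < cmod (z - 2^-1) by apply: lt_le_trans hd.
  rewrite /H ifF; last by apply/negP; rewrite -subr_eq0 -cmod_eq0 gt_eqF.
  rewrite cmodM cmodV ler_pdivrMr //.
  apply: le_trans (GA z) _; apply: le_trans (_ : B * E + A <= _).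
    rewrite lerD2r; apply: ler_pM; rewrite ?cmod_ge0 //.
      by apply: fB; case: bz.
    apply: le_trans (PB _ bz) _; rewrite ler_expR.
    by case: bz => /andP[? ?] _; nra.
  have : B * E + A <= 2 * A * T.
    by rewrite /T mulrDr mulr1 mulrCA divff ?mulr1; [lra|rewrite mulf_neq0].
  have := ler_wpM2l M0 hd; rewrite /M.
  have : 0 <= E * K * T by rewrite mulr_ge0 // ltW.
  nra.
have := maximum_principle T0 M0 Hcont Hharm Hbd (z := 2^-1).
have -> : cmod (H 2^-1) = A * lam.
  by rewrite /H eqxx dG cmodM cmod_real ger0_norm.
have bh : box T (2^-1 : C).
  by split; rewrite half_real /=; [lra|rewrite normr0 ltW].
move=> /(_ bh); rewrite /M; lra.
Qed.

End StripBound.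

(** * The Schreier norm and its dual on blocks *)

Section Sequences.
Variable R : realType.
Local Notation C := R[i].
Implicit Types (x y w : omega R) (M N n : nat).

Definition supported (s t : nat) w := forall j, ~~ (s <= j < t)%N -> w j = 0.

Lemma sum_supported (V : nmodType) (u : nat -> V) s t N : (s <= t <= N)%N ->
  (forall j, ~~ (s <= j < t)%N -> u j = 0) ->
  \sum_(0 <= j < N) u j = \sum_(s <= j < t) u j.
Proof.
move=> /andP[st tN] h.
rewrite (big_cat_nat (n := s)) //=; last exact: leq_trans tN.
rewrite [X in X + _]big_nat_cond big1 ?add0r; last first.
  by move=> j /andP[/andP[_ js] _]; apply: h; rewrite leqNgt js.
rewrite (big_cat_nat (n := t)) //= -[RHS]addr0; congr (_ + _).
rewrite big_nat_cond big1 // => j /andP[/andP[tj _] _].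
by apply: h; rewrite (ltnNge j) tj andbF.
Qed.

Lemma sum_fset_le (u : nat -> R) s t (A : {fset nat}) : (forall j, 0 <= u j) ->
  (forall j, ~~ (s <= j < t)%N -> u j = 0) ->
  \sum_(j <- A) u j <= \sum_(s <= j < t) u j.
Proof.
move=> u0 us.
have -> : \sum_(j <- A) u j = \sum_(j <- A | (s <= j < t)%N) u j.
  rewrite [RHS]big_mkcond; apply: eq_bigr => j _.
  by case: ifP => // /negbT/us.
rewrite -big_filter.
have p : perm_eq [seq j <- A | (s <= j < t)%N] [seq j <- index_iota s t | j \in A].
  apply: uniq_perm; rewrite ?filter_uniq ?iota_uniq ?fset_uniq //.
  by move=> j; rewrite !mem_filter mem_index_iota andbC.
rewrite (perm_big _ p) big_filter big_mkcond; apply: ler_sum => j _.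
by case: ifP.
Qed.

Lemma S2_nrm_le x (a : R) : 0 <= a ->
  (forall A, admissible A -> \sum_(j <- A) cmod (x j) ^+ 2 <= a ^+ 2) ->
  (S2_nrm x <= a%:E)%E.
Proof.
move=> a0 h; apply: ge_ereal_sup => _ [A Aadm <-].
by rewrite lee_fin -[leRHS]ger0_norm // -sqrtr_sqr ler_wsqrtr // h.
Qed.

Lemma S2_nrm_ge0 (x : omega R) : (0 <= S2_nrm x)%E.
Proof.
apply: ereal_sup_ubound; exists fset0; first by move=> j; rewrite inE.
by rewrite big_seq_fset0 sqrtr0.
Qed.

Lemma S2_nrm0 : S2_nrm (0 : omega R) = 0%E.
Proof.
apply/eqP; rewrite eq_le S2_nrm_ge0 andbT.
apply: S2_nrm_le => // A _; rewrite expr0n /= big1 // => j _.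
by rewrite cmod0 expr0n.
Qed.

(** The interval from M to 2 * M has M + 1 elements, so it is admissible for
    indices that start from 0. *)
Lemma S2_nrm_block x M (L : R) : (S2_nrm x <= L%:E)%E ->
  \sum_(M <= j < M.*2.+1) cmod (x j) ^+ 2 <= L ^+ 2.
Proof.
move=> xL; pose A := seq_fset tt (index_iota M M.*2.+1).
have u : uniq (index_iota M M.*2.+1) by exact: iota_uniq.
have pA : perm_eq A (index_iota M M.*2.+1).
  by apply: uniq_perm => // j; rewrite seq_fsetE.
have Aadm : admissible A.
  move=> j; rewrite seq_fsetE mem_index_iota => /andP[Mj _].
  by rewrite (perm_size pA) size_iota -addnn subSn ?leq_addr // addnK.
have : ((Num.sqrt (\sum_(j <- A) cmod (x j) ^+ 2))%:E <= L%:E)%E.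
  by apply: le_trans xL; apply: ereal_sup_ubound; exists A.
rewrite lee_fin (perm_big _ pA) /= => h.
have s0 : 0 <= \sum_(M <= j < M.*2.+1) cmod (x j) ^+ 2.
  by apply: sumr_ge0 => j _; exact: sqr_ge0.
rewrite -[leLHS]sqr_sqrtr // lerXn2r // nnegrE ?sqrtr_ge0 //.
exact: le_trans (sqrtr_ge0 _) h.
Qed.

Lemma S2_nrm_block_le1 w M : supported M M.*2.+1 w ->
  \sum_(M <= j < M.*2.+1) cmod (w j) ^+ 2 <= 1 -> (S2_nrm w <= 1)%E.
Proof.
move=> ws w1; apply: S2_nrm_le => // A _; rewrite expr1n.
apply: le_trans w1; apply: sum_fset_le => j; first exact: sqr_ge0.
by move=> /ws ->; rewrite cmod0 expr0n.
Qed.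

(** On such a block the norms of S2 and of its dual are both the Hilbert norm;
    here |ab| <= (a ^ 2 / L + L b ^ 2) / 2 replaces Cauchy-Schwarz. *)
Lemma block_pairing x w M N (L : R) : 0 < L -> (S2_nrm x <= L%:E)%E ->
  supported M M.*2.+1 w -> \sum_(M <= j < M.*2.+1) cmod (w j) ^+ 2 <= 1 ->
  (M.*2 < N)%N -> cmod (\sum_(0 <= j < N) x j * w j) <= L.
Proof.
move=> L0 xL ws w1 MN.
have {}xL := S2_nrm_block M xL.
rewrite (sum_supported (s := M) (t := M.*2.+1)).
- apply: le_trans (cmod_sum _ _ _) _.
  apply: le_trans (_ : \sum_(M <= j < M.*2.+1)
      ((2 * L)^-1 * cmod (x j) ^+ 2 + L / 2 * cmod (w j) ^+ 2) <= _).
    apply: ler_sum => j _; rewrite cmodM.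
    rewrite -(ler_pM2l (_ : 0 < 2 * L)) ?mulr_gt0 //.
    rewrite [leRHS](_ : _ = cmod (x j) ^+ 2 + L ^+ 2 * cmod (w j) ^+ 2); last first.
      by field; rewrite gt_eqF.
    have := sqr_ge0 (cmod (x j) - L * cmod (w j)); nra.
  rewrite big_split /= -!mulr_sumr.
  apply: le_trans (_ : (2 * L)^-1 * L ^+ 2 + L / 2 * 1 <= _).
    by apply: lerD; apply: ler_wpM2l => //; rewrite ?invr_ge0 ?mulr_ge0 ?ltW // divr_gt0.
  by rewrite le_eqVlt; apply/orP; left; apply/eqP; field; rewrite gt_eqF.
- by rewrite MN andbT -addnn -addnS leq_addr.
by move=> j /ws ->; rewrite mulr0.
Qed.

Lemma series_supported (u : nat -> C^o) N : (forall j, (N <= j)%N -> u j = 0) ->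
  series u @ \oo --> \sum_(0 <= j < N) u j.
Proof.
move=> u0; apply: cvg_near_cst; exists N => // n /= Nn.
rewrite /series /= (big_cat_nat (n := N)) //= -[RHS]addr0; congr (_ + _).
by rewrite big_nat_cond big1 // => j /andP[/andP[Nj _] _]; exact: u0.
Qed.

Lemma lim_series_supported (u : nat -> C^o) N : (forall j, (N <= j)%N -> u j = 0) ->
  limn (series u) = \sum_(0 <= j < N) u j.
Proof. by move=> h; apply: (@cvg_lim C^o) => //; exact: series_supported. Qed.

Lemma dual_nrm_pairing (X : seqspace R) x y N (L : R) :
  (dual_nrm X y <= L%:E)%E -> car X x -> (nrm X x <= 1)%E ->
  (forall j, (N <= j)%N -> x j = 0) ->
  cmod (\sum_(0 <= j < N) x j * y j) <= L.
Proof.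
move=> yL Xx x1 xN; rewrite -lee_fin; apply: le_trans yL.
apply: ereal_sup_ubound; exists x => //.
rewrite (lim_series_supported (N := N)) // => j /xN.
by rewrite /pairing_terms => ->; rewrite mul0r.
Qed.

Lemma dual_nrm_block_le1 w M : supported M M.*2.+1 w ->
  \sum_(M <= j < M.*2.+1) cmod (w j) ^+ 2 <= 1 -> (dual_nrm (S2 R) w <= 1)%E.
Proof.
move=> ws w1; apply: ge_ereal_sup => _ [x [_ x1] <-].
have -> : limn (series (pairing_terms x w)) = \sum_(0 <= j < M.*2.+1) x j * w j.
  apply: lim_series_supported => j Mj.
  by rewrite /pairing_terms ws ?mulr0 // (ltnNge j) Mj andbF.
by rewrite lee_fin; exact: (block_pairing ltr01 x1 ws w1 (ltnSn _)).
Qed.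

Lemma c00_S2 x : c00 x -> car (S2 R) x.
Proof. by move=> x0 e e0; exists x => //; rewrite subrr S2_nrm0 lte_fin. Qed.

Lemma supported_c00 s t w : supported s t w -> c00 w.
Proof.
move=> h; exists t => j tj; apply: h; by rewrite (ltnNge j) tj andbF.
Qed.

Lemma block_dual w M : supported M M.*2.+1 w ->
  \sum_(M <= j < M.*2.+1) cmod (w j) ^+ 2 <= 1 -> car (dual (S2 R)) w.
Proof.
move=> ws w1; split.
  move=> x _; apply/cvg_ex; exists (\sum_(0 <= j < M.*2.+1) x j * w j).
  apply: series_supported => j Mj.
  by rewrite /pairing_terms ws ?mulr0 // (ltnNge j) Mj andbF.
by apply: le_lt_trans (dual_nrm_block_le1 ws w1) _; rewrite ltry.
Qed.

Lemma dual_nrm0 (X : seqspace R) : (exists2 x, car X x & (nrm X x <= 1)%E) ->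
  dual_nrm X 0 = 0%E.
Proof.
have lim0 (x : omega R) : limn (series (pairing_terms x 0)) = 0.
  rewrite (lim_series_supported (N := 0)) ?big_geq // => j _.
  by rewrite /pairing_terms mulr0.
move=> [x Xx x1]; apply/eqP; rewrite eq_le; apply/andP; split.
  by apply: ge_ereal_sup => _ [z _ <-]; rewrite lim0 cmod0.
by apply: ereal_sup_ubound; exists x => //; rewrite lim0 cmod0.
Qed.

(** Blocks have norm at most 1 both in S2 and in its dual, so the constant
    function shows that the derived space contains the Hilbert space on the block
    as pairs with first entry 0. *)
Lemma in_calF_cst w M : supported M M.*2.+1 w ->
  \sum_(M <= j < M.*2.+1) cmod (w j) ^+ 2 <= 1 ->
  in_calF (S2 R) (dual (S2 R)) (fun=> w) /\
  (calF_nrm (S2 R) (dual (S2 R)) (fun=> w) <= 1)%E.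
Proof.
move=> ws w1.
have n1 := S2_nrm_block_le1 ws w1; have n2 := dual_nrm_block_le1 ws w1.
have e1 : (edge_nrm (S2 R) 0%R (fun=> w) <= 1)%E by apply: ge_ereal_sup => _ [t _ <-].
have e2 : (edge_nrm (dual (S2 R)) 1%R (fun=> w) <= 1)%E by apply: ge_ereal_sup => _ [t _ <-].
split; last by rewrite /calF_nrm ge_max e1.
split.
- by move=> j; apply/bounded_cmod; exists (cmod (w j)) => z _; exact: lexx.
- move=> j; apply/subspace_continuousP => z _; exact: cvg_cst.
- move=> j z _; exists (fun n => if n == 0%N then w j else 0).
  near=> y; rewrite [X in _ --> X](_ : _ = \sum_(0 <= n < 1)
     (if n == 0%N then w j else 0) * (y - z) ^+ n); last first.
    by rewrite big_nat1 mulr1.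
  by apply: series_supported => -[|n] // _; rewrite mul0r.
- by move=> t; apply: c00_S2; exact: supported_c00 ws.
- by apply: le_lt_trans e1 _; rewrite ltry.
- by move=> t; rewrite subrr /= S2_nrm0; exact: cvg_cst.
- by move=> t; exact: block_dual ws w1.
- by apply: le_lt_trans e2 _; rewrite ltry.
move=> t; rewrite subrr /= dual_nrm0; first exact: cvg_cst.
by exists 0; [apply: c00_S2; exists 0%N | rewrite /= S2_nrm0].
Unshelve. all: by end_near.
Qed.

Lemma Z_nrm_block_le1 w M : supported M M.*2.+1 w ->
  \sum_(M <= j < M.*2.+1) cmod (w j) ^+ 2 <= 1 -> (Z_nrm (S2 R) (0%R, w) <= 1)%E.
Proof.
move=> ws w1; have [h1 h2] := in_calF_cst ws w1.
apply: le_trans h2; apply: ereal_inf_lbound.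
exists (fun=> w) => //; split => // j.
by rewrite derive1_cst.
Qed.

End Sequences.

(** * Linear functionals of analytic maps *)

Section Functional.
Variable R : realType.
Local Notation C := R[i].
Variables (X Y : seqspace R) (F : C^o -> omega R).
Hypothesis FF : in_calF X Y F.

Definition functional (b : omega R) (N : nat) (z : C^o) : C^o :=
  \sum_(0 <= j < N) F z j * b j.

Lemma functional_recr b N :
  functional b N.+1 = (fun z => b N * F z N + functional b N z).
Proof. by apply/funext => z; rewrite /functional big_nat_recr //= addrC mulrC. Qed.

Lemma functional0 b : functional b 0 = (fun=> 0).
Proof. by apply/funext => z; rewrite /functional big_geq. Qed.

Lemma functional_bounded b N :
  exists B : R, forall z, strip z -> cmod (functional b N z) <= B.
Proof.
elim: N => [|N [B hB]].
  by exists 0 => z _; rewrite functional0 cmod0.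
have /bounded_cmod[B' hB'] := calF_bounded FF N.
exists (cmod (b N) * B' + B) => z sz; rewrite functional_recr.
apply: le_trans (cmodD _ _) _; rewrite cmodM lerD ?hB //.
by rewrite ler_wpM2l ?cmod_ge0 // hB'.
Qed.

Lemma functional_continuous b N : {within @strip R, continuous (functional b N)}.
Proof.
elim: N => [|N IH].
  by rewrite functional0; apply/subspace_continuousP => z _; exact: cvg_cst.
rewrite functional_recr; apply/subspace_continuousP => z sz.
apply: cvgD.
  have h0 : {within @strip R, continuous (fun z => F z N)} :=
    @calF_continuous _ _ _ _ FF N.
  have /subspace_continuousP/(_ _ sz) h := h0.
  exact: cvgMr h.
by have /subspace_continuousP/(_ _ sz) := IH.
Qed.

Lemma powser_at0 a : powser_at (fun=> 0) (a : C^o) (0 : omega R).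
Proof.
apply/near_cmod; exists 1 => // z _.
rewrite [X in _ --> X](_ : _ = \sum_(0 <= n < 0) ((0 : omega R) n * (z - a) ^+ n : C^o)).
  by apply: series_supported => j _; rewrite mul0r.
by rewrite big_geq.
Qed.

Lemma strip_interior (z : C^o) : 0 < complex.Re z < 1 -> (@strip R)° z.
Proof.
move=> /andP[z0 z1]; apply/near_cmod.
exists (Num.min (complex.Re z) (1 - complex.Re z)).
  by rewrite lt_min z0 subr_gt0.
move=> x; rewrite lt_min => /andP[h1 h2].
have := le_lt_trans (ler_Re_cmod _) h1; have := le_lt_trans (ler_Re_cmod _) h2.
rewrite raddfB /= !ltr_norml => /andP[? ?] /andP[? ?].
by rewrite /strip /=; apply/andP; split; lra.
Qed.

Lemma functional_analytic b N (z : C^o) : 0 < complex.Re z < 1 ->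
  exists2 c, powser_at (functional b N) z c &
    ((forall j, derive1 (fun z : C => F z j) z = 0) -> c 1%N = 0).
Proof.
move=> z01; elim: N => [|N [c hc c1]].
  by exists 0 => //; rewrite functional0; exact: powser_at0.
have [d hd] := calF_analytic FF N (strip_interior z01).
exists (fun n => b N * d n + c n).
  by rewrite functional_recr; exact: powser_at_lin.
move=> h; rewrite c1 // addr0 -(powser_derive1 (hd : powser_at _ _ _)).
by rewrite h mulr0.
Qed.

End Functional.

(** * Signed sums of spread blocks *)

Section SpreadBlocks.
Variable R : realType.
Local Notation C := R[i].

(** Normalised vectors on successive admissible intervals, each so flat that an
    admissible set beginning in an earlier interval sees at most the fraction 1/n
    of its squared norm. S2 then treats n of them like the unit vectors of
    l_infty^n. *)
Record spread_blocks (n : nat) (M : nat -> nat) (w : nat -> omega R) : Prop := {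
  spread_supported : forall k, supported (M k) (M k).*2.+1 (w k);
  spread_unit : forall k, \sum_(M k <= j < (M k).*2.+1) cmod (w k j) ^+ 2 = 1;
  spread_disjoint : forall i k, (i < k)%N -> ((M i).*2 < M k)%N;
  spread_flat : forall i k j, (i < k)%N ->
    (n * (M i).*2.+1)%:R * cmod (w k j) ^+ 2 <= 1 }.

Variables (n : nat) (M : nat -> nat) (w : nat -> omega R).
Hypothesis Hw : spread_blocks n M w.
Variable eps : nat -> C.
Hypothesis eps1 : forall k, cmod (eps k) = 1.

Definition signed_sum : omega R := fun j => \sum_(0 <= k < n) eps k * w k j.

Lemma blocks_disjoint i k j : (M i <= j < (M i).*2.+1)%N -> (M k <= j < (M k).*2.+1)%N ->
  i = k.
Proof.
move=> /andP[i1 i2] /andP[k1 k2]; case: (ltngtP i k) => // ik.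
  have := spread_disjoint Hw ik; lia.
have := spread_disjoint Hw ik; lia.
Qed.

Lemma sqr_cmod_signed_sum j :
  cmod (signed_sum j) ^+ 2 = \sum_(0 <= k < n) cmod (w k j) ^+ 2.
Proof.
rewrite /signed_sum !big_mkord.
have [[k jk]|none] := pselect (exists k : 'I_n, (M k <= j < (M k).*2.+1)%N).
  have z (i : 'I_n) : i != k -> w i j = 0.
    move=> ik; apply: (spread_supported Hw); apply: contra ik => ij.
    by apply/eqP/val_inj; exact: blocks_disjoint ij jk.
  rewrite (bigD1 k) //= [in RHS](bigD1 k) //= !big1 ?addr0.
  - by rewrite cmodM eps1 mul1r.
  - by move=> i /z ->; rewrite cmod0 expr0n.
  by move=> i /z ->; rewrite mulr0.
have z (i : 'I_n) : w i j = 0.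
  by apply: (spread_supported Hw); apply/negP => ij; apply: none; exists i.
by rewrite !big1 ?cmod0 ?expr0n // => i _; rewrite z ?mulr0 ?cmod0 ?expr0n.
Qed.

(** If i is the first block met by A, then A has at most 2 * M i + 1 elements:
    block i contributes at most 1, each of the later ones at most 1/n. *)
Lemma admissible_sum_le A : (0 < n)%N -> admissible A ->
  \sum_(j <- A) cmod (signed_sum j) ^+ 2 <= 2.
Proof.
move=> n0 Aadm; under eq_bigr do rewrite sqr_cmod_signed_sum.
rewrite exchange_big /=.
have nr : 0 < n%:R :> R by rewrite ltr0n.
pose meets k := has (fun j => (M k <= j < (M k).*2.+1)%N) A.
have z k : ~~ meets k -> \sum_(j <- A) cmod (w k j) ^+ 2 = 0.
  move=> /hasPn h; rewrite big_seq big1 // => j /h jk.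
  by rewrite (spread_supported Hw) // cmod0 expr0n.
have [ex|none] := pselect (exists k, meets k); last first.
  rewrite big1 // => k _; apply: z; apply/negP => mk; apply: none; by exists k.
case: (ex_minnP ex) => i /hasP[j0 j0A /andP[_ j0i]] imin.
have Asz : (size A <= (M i).*2.+1)%N.
  by apply: leq_trans (Aadm _ j0A) _.
apply: le_trans (_ : \sum_(0 <= k < n) ((k == i)%:R + n%:R^-1) <= _).
  apply: ler_sum => k _; case: (ltngtP k i) => [ki|ik|->].
  - rewrite z ?addr_ge0 ?invr_ge0 ?(ltW nr) //.
    by apply/negP => /imin; rewrite leqNgt ki.
  - rewrite add0r.
    apply: le_trans (_ : \sum_(j <- A) (n * (M i).*2.+1)%:R^-1 <= _).
      apply: ler_sum => j _; rewrite -[leRHS]mul1r ler_pdivlMr ?ltr0n ?muln_gt0 ?n0 //.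
      by rewrite mulrC; exact: spread_flat.
    rewrite big_const_seq count_predT iter_addr_0 -[_ *+ size A]mulr_natr natrM invfM.
    rewrite -mulrA ger_pMr ?invr_gt0 // mulrC ler_pdivrMr ?ltr0n // mul1r.
    by rewrite ler_nat.
  rewrite -[leLHS]addr0; apply: lerD; last by rewrite invr_ge0 ltW.
  rewrite -[1%:R](spread_unit Hw i); apply: sum_fset_le => j.
    exact: sqr_ge0.
  by move=> /(spread_supported Hw) ->; rewrite cmod0 expr0n.
rewrite big_split /= sumr_const_nat subn0 -[_ *+ n]mulr_natr mulVf ?gt_eqF //.
rewrite lerD2r -natr_sum.
have : (\sum_(0 <= k < n) (k == i) <= 1)%N.
  rewrite big_mkord; have [ii|ii] := ltnP i n.
    rewrite (bigD1 (Ordinal ii)) //= eqxx big1 // => k /negPf.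
    by rewrite -val_eqE /= => ->.
  rewrite big1 // => k _; have : (k < i)%N by exact: leq_trans ii.
  by move=> /ltn_eqF ->.
by rewrite -(ler_nat R).
Qed.

End SpreadBlocks.

(** * Lower bound for the norm of the derived space *)

Section LowerBound.
Variable R : realType.
Local Notation C := R[i].

Variables (n : nat) (M : nat -> nat) (w : nat -> omega R).
Hypothesis n0 : (0 < n)%N.
Hypothesis Hw : spread_blocks n M w.
Variable eps : nat -> C.
Hypothesis eps1 : forall k, cmod (eps k) = 1.
Local Notation y := (signed_sum n w eps).
Local Notation ybar := (fun j => (y j)^*%C : C^o).

Let N := (M n).*2.+1.

Let MN k : (k < n)%N -> ((M k).*2 < N)%N.
Proof.
move=> kn; have := spread_disjoint Hw kn; rewrite /N -addnn; lia.
Qed.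

Lemma signed_sum_supported j : (N <= j)%N -> y j = 0.
Proof.
move=> Nj; rewrite /signed_sum big_nat big1 // => k /andP[_ kn].
rewrite (spread_supported Hw) ?mulr0 //; apply/negP => /andP[_ jk].
have := MN kn; lia.
Qed.

(** Each block contributes at most L, as in the dual of l_infty^n. *)
Lemma pairing_left x (L : R) : 0 < L -> (S2_nrm x <= L%:E)%E ->
  cmod (\sum_(0 <= j < N) x j * ybar j) <= n%:R * L.
Proof.
move=> L0 xL.
have -> : \sum_(0 <= j < N) x j * ybar j =
   \sum_(0 <= k < n) (eps k)^*%C * \sum_(0 <= j < N) x j * (w k j)^*%C.
  under eq_bigr => j _ do rewrite /signed_sum rmorph_sum mulr_sumr.
  rewrite exchange_big /=; apply: eq_bigr => k _.
  rewrite mulr_sumr; apply: eq_bigr => j _.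
  by rewrite rmorphM /= mulrCA.
apply: le_trans (cmod_sum _ _ _) _.
rewrite -[n in leRHS]subn0 mulr_natl -sumr_const_nat big_nat [leRHS]big_nat.
apply: ler_sum => k /andP[_ kn]; rewrite cmodM cmodJ eps1 mul1r.
apply: (block_pairing (w := fun j => (w k j)^*%C) (M := M k)) => //.
- by move=> j /(spread_supported Hw) ->; rewrite conjc0.
- under eq_bigr do rewrite cmodJ.
  by rewrite (spread_unit Hw).
exact: MN.
Qed.

(** The vector conj y has norm at most sqrt 2 in S2, so its half is in the unit
    ball that defines the dual norm. *)
Lemma pairing_right x (L : R) : (dual_nrm (S2 R) x <= L%:E)%E ->
  cmod (\sum_(0 <= j < N) x j * ybar j) <= 2 * L.
Proof.
move=> xL.
pose h : omega R := fun j => (2^-1)%:C * (y j)^*%C.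
have h0 j : (N <= j)%N -> h j = 0.
  by move=> /signed_sum_supported; rewrite /h => ->; rewrite conjc0 mulr0.
have hn : (S2_nrm h <= 1)%E.
  apply: S2_nrm_le => // A Aadm.
  under eq_bigr => j _ do rewrite /h cmodM cmodJ cmod_real exprMn.
  rewrite -mulr_sumr gtr0_norm //.
  have := admissible_sum_le Hw eps1 n0 Aadm; lra.
have := dual_nrm_pairing xL (c00_S2 (ex_intro _ N h0)) hn h0.
have -> : \sum_(0 <= j < N) h j * x j = (2^-1)%:C * \sum_(0 <= j < N) x j * ybar j.
  by rewrite mulr_sumr; apply: eq_bigr => j _; rewrite /h; ring.
rewrite cmodM cmod_real gtr0_norm // => hh.
lra.
Qed.

Lemma pairing_self : \sum_(0 <= j < N) y j * ybar j = n%:R.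
Proof.
have -> : \sum_(0 <= j < N) y j * ybar j = (\sum_(0 <= j < N) cmod (y j) ^+ 2)%:C.
  by rewrite rmorph_sum; apply: eq_bigr => j _; rewrite cmod_mulJ.
under eq_bigr do rewrite (sqr_cmod_signed_sum Hw eps1).
rewrite exchange_big /= big_nat.
rewrite (eq_bigr (fun=> 1)); last first.
  move=> k /andP[_ kn]; rewrite -[RHS](spread_unit Hw k).
  apply: sum_supported; first by rewrite MN // andbT -addnn; lia.
  by move=> j /(spread_supported Hw) ->; rewrite cmod0 expr0n.
by rewrite -big_nat sumr_const_nat subn0 rmorph_nat.
Qed.

(** For a function F representing the pair, f = <F, conj y> is at most n * L on
    the left edge and 2 * L on the right edge, where L is the norm of F, while
    f (1/2) = c * n and f' (1/2) = 0. The derivative estimate with lam = ln n gives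
    (ln n - 2) * c * n <= 8 * sqrt n * L. *)
Lemma Z_nrm_signed_sum_ge (c : R) : 0 < c ->
  ((c * Num.sqrt n%:R * (ln n%:R - 2) / 8)%:E <=
     Z_nrm (S2 R) (0, (fun j => c%:C * y j) : omega R)%R)%E.
Proof.
move=> c0; apply: le_ereal_inf_tmp => _ [F [FF F1 F2] <-].
have nr : 0 < n%:R :> R by rewrite ltr0n.
have main (L : R) : 0 < L -> (edge_nrm (S2 R) 0%R F <= L%:E)%E ->
    (edge_nrm (dual (S2 R)) 1%R F <= L%:E)%E ->
    c * Num.sqrt n%:R * (ln n%:R - 2) / 8 <= L.
  move=> L0 e0 e1.
  pose f := functional F ybar N.
  have [B fB] := functional_bounded FF ybar N.
  have fc : {within @strip R, continuous f}.
    by apply: (functional_continuous FF).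
  have fan z : 0 < complex.Re z < 1 -> exists d, powser_at f z d.
    by move=> z01; have [d hd _] := functional_analytic FF ybar N z01; exists d.
  have half01 : 0 < complex.Re (2^-1 : C) < 1.
    by rewrite half_real /=; apply/andP; split; lra.
  have df : derive1 (fun z : C => f z) 2^-1 = 0.
    have [d hd d1] := functional_analytic FF ybar N half01.
    by rewrite (powser_derive1 hd) d1.
  have lam0 : 0 <= ln n%:R :> R by rewrite ln_ge0 // ler1n.
  have fl t : cmod (f (0 +i* t)) <= expR (ln n%:R) * (2 * L).
    have h : (S2_nrm (F (0 +i* t)%R) <= L%:E)%E.
      by apply: le_trans e0; apply: ereal_sup_ubound; exists t.
    have h2 : cmod (f (0 +i* t)) <= n%:R * L := pairing_left L0 h.
    apply: le_trans h2 _; rewrite lnK ?posrE //.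
    by rewrite ler_wpM2l ?(ltW nr) //; lra.
  have fr t : cmod (f (1 +i* t)) <= 2 * L.
    have h : (dual_nrm (S2 R) (F (1 +i* t)%R) <= L%:E)%E.
      by apply: le_trans e1; apply: ereal_sup_ubound; exists t.
    exact: (pairing_right h).
  have := strip_derivative_bound lam0 fB fc fan df fl fr.
  rewrite -/f; have -> : f 2^-1 = c%:C * n%:R.
    rewrite -pairing_self mulr_sumr; apply: eq_bigr => j _.
    by rewrite F1 mulrA.
  rewrite cmodM cmod_real gtr0_norm // -(rmorph_nat (real_complex R)) cmod_real.
  rewrite gtr0_norm //.
  set s := Num.sqrt n%:R.
  have s0 : 0 < s by rewrite sqrtr_gt0.
  have sn : s ^+ 2 = n%:R by rewrite sqr_sqrtr // ltW.
  have es : expR ((ln n%:R + 1) / 2) <= 2 * s.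
    rewrite -(ler_pXn2r (n := 2)) ?nnegrE ?expR_ge0 ?mulr_ge0 ?(ltW s0) //.
    rewrite -expRM_natl exprMn sn.
    have -> : 2 * ((ln n%:R + 1) / 2) = ln n%:R + 1 :> R by field.
    rewrite expRD lnK ?posrE // mulrC ler_wpM2r ?(ltW nr) //.
    have h2 : expR (2^-1) <= 2 :> R.
      have := expR_ge1Dx (- 2^-1 : R); rewrite expRN => h2.
      rewrite -[leRHS]invrK -[leLHS]invrK lef_pV2 ?posrE ?invr_gt0 ?expR_gt0 //; lra.
    have -> : expR 1 = expR 2^-1 ^+ 2 :> R by rewrite -expRM_natl divff.
    by rewrite lerXn2r ?nnegrE ?expR_ge0.
  set l := ln n%:R => h; rewrite -(ler_pM2l s0).
  have -> : s * (c * s * (l - 2) / 8) = (l - 2) * (c * n%:R) / 8.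
    by rewrite -sn; ring.
  have := ler_wpM2r (ltW L0) es; lra.
have e00 : (0 <= edge_nrm (S2 R) 0%R F)%E.
  apply: le_trans (S2_nrm_ge0 (F (0 +i* 0)%R)) _.
  by apply: ereal_sup_ubound; exists 0.
have lty : (calF_nrm (S2 R) (dual (S2 R)) F < +oo)%E.
  by rewrite /calF_nrm gt_max (calF_left_bounded FF) (calF_right_bounded FF).
have ge0 : (0 <= calF_nrm (S2 R) (dual (S2 R)) F)%E.
  by rewrite /calF_nrm le_max e00.
have /fineK eL : calF_nrm (S2 R) (dual (S2 R)) F \is a fin_num.
  by rewrite ge0_fin_numE.
have L0 : 0 <= fine (calF_nrm (S2 R) (dual (S2 R)) F) by rewrite fine_ge0.
rewrite -eL lee_fin; apply/ler_addgt0Pr => e e0.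
apply: main; first by rewrite ltr_wpDl.
  apply: le_trans (_ : (calF_nrm (S2 R) (dual (S2 R)) F <= _)%E).
    by rewrite /calF_nrm le_max lexx.
  by rewrite -[leLHS]eL lee_fin lerDl ltW.
apply: le_trans (_ : (calF_nrm (S2 R) (dual (S2 R)) F <= _)%E).
  by rewrite /calF_nrm le_max lexx orbT.
by rewrite -[leLHS]eL lee_fin lerDl ltW.
Qed.

End LowerBound.

(** * Spread blocks in subspaces of finite codimension *)

Section Subspace.
Variable R : realType.
Local Notation C := R[i].
Local Notation V := (omega R * omega R)%type.
Local Notation NZ := (Z_nrm (S2 R)).

Definition vert (w : omega R) : V := (0, w).

Lemma vert_linear (k : C) (u w : omega R) : vert (k *: u + w) = k *: vert u + vert w.
Proof.
rewrite /vert; congr pair; apply/funext => j /=.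
by rewrite !fctE /= scaler0 addr0.
Qed.

Lemma vertZ (k : C) (w : omega R) : vert (k *: w) = k *: vert w.
Proof. by rewrite -[_ *: w]addr0 vert_linear addr0. Qed.

Lemma vert_sum I (r : seq I) (k : I -> C) (w : I -> omega R) :
  vert (\sum_(i <- r) k i *: w i) = \sum_(i <- r) k i *: vert (w i).
Proof. elim/big_rec2: _ => [//|i y z _ <-]; exact: vert_linear. Qed.

Variables (X : set V).
Hypothesis Xsub : is_subspace X.

Lemma subspace_sum (I : Type) (r : seq I) (k : I -> C) (v : I -> V) :
  (forall i, X (v i)) -> X (\sum_(i <- r) k i *: v i).
Proof.
case: Xsub => X0 XD Xv; elim: r => [|i r IH]; first by rewrite big_nil.
by rewrite big_cons; apply: XD.
Qed.

Lemma subspaceZ (k : C) v : X v -> X (k *: v).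
Proof. by case: Xsub => X0 XD Xv; have := XD k v 0 Xv X0; rewrite addr0. Qed.

Lemma subspaceD u v : X u -> X v -> X (u + v).
Proof. by case: Xsub => X0 XD Xu Xv; rewrite -[u]scale1r; apply: XD. Qed.

Variables (m : nat) (s : 'I_m -> V).
Hypothesis Xcodim : forall w, (NZ w < +oo)%E -> exists2 x, X x &
      exists a : 'I_m -> C, w = x + \sum_i a i *: s i.

Definition unit_seq (j : nat) : omega R := fun i => (i == j)%:R.

Lemma unit_seq_fin j : (NZ (vert (unit_seq j)) < +oo)%E.
Proof.
apply: le_lt_trans (Z_nrm_block_le1 (M := j) _ _) _; last by rewrite ltry.
  move=> i; rewrite /unit_seq; case: eqVneq => // ->.
  by rewrite leqnn /= ltnS -addnn leq_addr.
rewrite big_nat_recl /unit_seq; last by rewrite -addnn leq_addr.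
rewrite eqxx cmod1 expr1n big_nat big1 ?addr0 // => i /andP[ji _].
by rewrite gtn_eqF ?ltnS // cmod0 expr0n.
Qed.

(** A subspace of codimension m meets the (m + 1)-dimensional space of the pairs
    (0, u) with u supported on m + 1 given coordinates. *)
Lemma subspace_unit t : exists w : omega R, [/\ supported t (t + m.+1) w,
  \sum_(t <= j < t + m.+1) cmod (w j) ^+ 2 = 1 & X (vert w)].
Proof.
have /choice[x xP] : forall i : 'I_m.+1, exists x : V * ('I_m -> C),
    X x.1 /\ vert (unit_seq (t + i)) = x.1 + \sum_l x.2 l *: s l.
  move=> i; have [x Xx [a e]] := Xcodim (unit_seq_fin (t + i)).
  by exists (x, a).
pose A := \matrix_(i < m.+1, l < m) (x i).2 l.
(* A has more rows than columns; its left kernel combines the m + 1 pairs so as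
   to cancel their components on the complement. *)
have kA : kermx A != 0.
  rewrite kermx_eq0 /row_free; apply/eqP => rA.
  by have := rank_leq_col A; rewrite rA ltnn.
have [u /sub_kermxP uA u0] := rowV0Pn kA.
pose w' : omega R := \sum_i u 0 i *: unit_seq (t + i).
have Xw' : X (vert w').
  have -> : vert w' = \sum_i u 0 i *: (x i).1.
    rewrite /w' vert_sum.
    under eq_bigr => i _ do rewrite (xP i).2 scalerDr.
    rewrite big_split /= [X in _ + X](_ : _ = 0) ?addr0 //.
    under eq_bigr do rewrite scaler_sumr.
    rewrite exchange_big big1 //= => l _.
    under eq_bigr do rewrite scalerA.
    rewrite -scaler_suml; have := congr1 (fun B : 'rV[C]_m => B 0 l) uA.
    rewrite !mxE => e; rewrite [X in X *: _](_ : _ = 0) ?scale0r // -[RHS]e.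
    by apply: eq_bigr => i _; rewrite mxE.
  by apply: subspace_sum => i; exact: (xP i).1.
have w'E j : w' j = \sum_i u 0 i * (j == (t + i)%N)%:R.
  by rewrite /w' fct_sumE.
have w'0 : supported t (t + m.+1) w'.
  move=> j jt; rewrite w'E big1 // => i _.
  case: eqP => [e|]; last by rewrite mulr0.
  by move: jt; rewrite e leq_addr ltn_add2l ltn_ord.
have w'i (i : 'I_m.+1) : w' (t + i)%N = u 0 i.
  rewrite w'E (bigD1 i) //= eqxx mulr1 big1 ?addr0 // => l li.
  by rewrite eqn_add2l [_ == _]eq_sym (inj_eq val_inj) (negPf li) mulr0.
set S := \sum_(t <= j < t + m.+1) cmod (w' j) ^+ 2.
have S0 : 0 < S.
  rewrite /S -{1}[t]add0n big_addn addKn big_mkord.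
  have [i ui] : exists i, u 0 i != 0 by apply/rV0Pn.
  rewrite (bigD1 i) //= ltr_pwDl //.
    by rewrite addnC w'i exprn_gt0 // cmod_gt0.
  by apply: sumr_ge0 => l _; exact: sqr_ge0.
exists ((Num.sqrt S)^-1%:C *: w'); split.
- by move=> j /w'0; rewrite !fctE => ->; rewrite scaler0.
- under eq_bigr => j _ do rewrite !fctE cmodM cmod_real exprMn.
  rewrite -mulr_sumr -/S gtr0_norm ?invr_gt0 ?sqrtr_gt0 //.
  by rewrite exprVn sqr_sqrtr ?mulVf ?gt_eqF // ltW.
by rewrite vertZ; exact: subspaceZ.
Qed.

(** Adding up unit vectors from G consecutive groups of m + 1 coordinates makes
    the result flat: its squared norm is G, its entries are at most 1. *)
Lemma subspace_spread_sum t G : exists w : omega R,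
  [/\ supported t (t + G * m.+1) w,
  \sum_(t <= j < t + G * m.+1) cmod (w j) ^+ 2 = G%:R,
  forall j, cmod (w j) ^+ 2 <= 1 & X (vert w)].
Proof.
elim: G => [|G [w [w0 w1 wle Xw]]].
  exists 0; split => //.
  - by rewrite mul0n addn0 big_geq.
  - by move=> j; rewrite cmod0 expr0n.
  by case: Xsub.
have [z [z0 z1 Xz]] := subspace_unit (t + G * m.+1).
have tE : (t + G.+1 * m.+1 = t + G * m.+1 + m.+1)%N by rewrite mulSn; lia.
have wz j : (j < t + G * m.+1)%N -> z j = 0.
  by move=> jt; apply: z0; rewrite leqNgt jt.
have zw j : (t + G * m.+1 <= j)%N -> w j = 0.
  by move=> jt; apply: w0; rewrite (ltnNge j) jt andbF.
exists (w + z); split.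
- move=> j jt; rewrite fctE w0 ?z0 ?addr0 //; apply: contra jt; rewrite tE; lia.
- rewrite tE (big_cat_nat (n := (t + G * m.+1)%N)) ?leq_addr //=.
  rewrite -natr1 -w1 -z1; congr (_ + _); rewrite big_nat [RHS]big_nat;
    apply: eq_bigr => j /andP[j1 j2]; rewrite fctE.
    by rewrite (wz j) ?addr0.
  by rewrite zw ?add0r.
- move=> j; rewrite fctE; have [jt|jt] := ltnP j (t + G * m.+1).
    by rewrite (wz j) ?addr0.
  rewrite zw // add0r; have [jt2|jt2] := ltnP j (t + G * m.+1 + m.+1).
    rewrite -z1 (bigD1_seq j) /= ?mem_index_iota ?jt ?iota_uniq //.
    by rewrite lerDl sumr_ge0 // => l _; exact: sqr_ge0.
  by rewrite z0 ?cmod0 ?expr0n // (ltnNge j) jt2 andbF.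
rewrite -[w]scale1r vert_linear scale1r; exact: subspaceD.
Qed.

(** After normalisation, the squared entries on block k are at most 1 / G k;
    geometric growth of G makes this small against the length of the earlier
    blocks. Each block starts at the index G k * d which equals its length, so
    that it lies in an admissible interval. *)
Lemma subspace_spread_blocks n : (0 < n)%N ->
  exists (M : nat -> nat) (w : nat -> omega R),
  spread_blocks n M w /\ forall k, X (vert (w k)).
Proof.
move=> n0; pose d := m.+1; pose G k := ((3 * d * n) ^ k)%N; pose M k := (G k * d)%N.
have G0 k : (0 < G k)%N by rewrite expn_gt0 !muln_gt0 n0.
have Gik i k : (i < k)%N -> (3 * d * n * G i <= G k)%N.
  by move=> ik; rewrite /G -expnS leq_pexp2l // !muln_gt0 n0.
have /choice[w wP] : forall k, exists w : omega R,
    [/\ supported (M k) (M k).*2.+1 w,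
       \sum_(M k <= j < (M k).*2.+1) cmod (w j) ^+ 2 = 1,
       forall j, (G k)%:R * cmod (w j) ^+ 2 <= 1 & X (vert w)].
  move=> k; have [w [w0 w1 wle Xw]] := subspace_spread_sum (M k) (G k).
  have ME : (M k + G k * m.+1 = (M k).*2)%N by rewrite -addnn.
  rewrite ME in w0 w1.
  have Gr : 0 < (G k)%:R :> R by rewrite ltr0n.
  pose c := (Num.sqrt (G k)%:R)^-1 : R.
  have c2 : cmod c%:C ^+ 2 = (G k)%:R^-1.
    rewrite cmod_real gtr0_norm ?invr_gt0 ?sqrtr_gt0 //.
    by rewrite exprVn sqr_sqrtr // ltW.
  exists (c%:C *: w); split.
  - move=> j jM; rewrite fctE w0 ?scaler0 //; apply: contra jM; lia.
  - under eq_bigr => j _ do rewrite !fctE cmodM exprMn c2.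
    rewrite -mulr_sumr big_nat_recr /=; last by rewrite -addnn leq_addr.
    rewrite w1 w0 ?cmod0 ?expr0n ?addr0 ?mulVf ?gt_eqF //.
    by rewrite ltnn andbF.
  - by move=> j; rewrite !fctE cmodM exprMn c2 mulrA mulfV ?gt_eqF // mul1r.
  by rewrite vertZ; exact: subspaceZ.
exists M, w; split; last by move=> k; have [] := wP k.
split.
- by move=> k; have [] := wP k.
- by move=> k; have [] := wP k.
- move=> i k ik; have := Gik _ _ ik; have := G0 i; rewrite /M /d; nia.
move=> i k j ik; have [_ _ h _] := wP k.
apply: le_trans (h j); rewrite ler_wpM2r ?sqr_ge0 // ler_nat.
apply: leq_trans (Gik _ _ ik); have := G0 i; rewrite /M /d; nia.
Qed.

End Subspace.

(** * Distance to Hilbert space *)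

Section Hilbert.
Variable R : realType.
Local Notation C := R[i].
Variable n : nat.
Implicit Types a b : 'rV[C]_n.

Lemma sqr_l2_nrm a : l2_nrm a ^+ 2 = \sum_i cmod (a 0 i) ^+ 2.
Proof. by rewrite sqr_sqrtr // sumr_ge0 // => i _; exact: sqr_ge0. Qed.

Lemma l2_nrm_ge0 a : 0 <= l2_nrm a.
Proof. exact: sqrtr_ge0. Qed.

Lemma l2_nrm_gt0 a : a != 0 -> 0 < l2_nrm a.
Proof.
move=> /rV0Pn[i ai]; rewrite sqrtr_gt0 (bigD1 i) //= ltr_pwDl //.
  by rewrite exprn_gt0 // cmod_gt0.
by apply: sumr_ge0 => j _; exact: sqr_ge0.
Qed.

Lemma l2_nrmZ (k : C) a : l2_nrm (k *: a) = cmod k * l2_nrm a.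
Proof.
apply/eqP; rewrite -(eqrXn2 (n := 2)) ?mulr_ge0 ?l2_nrm_ge0 ?cmod_ge0 //.
rewrite exprMn !sqr_l2_nrm mulr_sumr; apply/eqP/eq_bigr => i _.
by rewrite mxE cmodM exprMn.
Qed.

Lemma l2_parallelogram a b :
  l2_nrm (a + b) ^+ 2 + l2_nrm (a - b) ^+ 2 = 2 * (l2_nrm a ^+ 2 + l2_nrm b ^+ 2).
Proof.
rewrite !sqr_l2_nrm -!big_split mulr_sumr; apply: eq_bigr => i _ /=.
rewrite !mxE !sqr_cmod; case: (a 0 i) => ? ?; case: (b 0 i) => ? ? /=; ring.
Qed.

(** Hilbert space has type 2 with constant 1: by the parallelogram law, the
    squared norm of a + b or that of a - b is at most the sum of the squares. *)
Lemma signs_l2_nrm_le (v : nat -> 'rV[C]_n) N : exists eps : nat -> C,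
  (forall k, cmod (eps k) = 1) /\
  l2_nrm (\sum_(0 <= k < N) eps k *: v k) ^+ 2 <= \sum_(0 <= k < N) l2_nrm (v k) ^+ 2.
Proof.
elim: N => [|N [eps [eps1 h]]].
  exists (fun=> 1); split=> [k|]; first exact: cmod1.
  rewrite !big_geq // sqr_l2_nrm big1 // => i _.
  by rewrite mxE cmod0 expr0n.
set s := \sum_(0 <= k < N) _ in h.
have [e e1 he] : exists2 e : C, cmod e = 1 &
    l2_nrm (s + e *: v N) ^+ 2 <= l2_nrm s ^+ 2 + l2_nrm (v N) ^+ 2.
  have p := l2_parallelogram s (v N).
  have [le|lt] := lerP (l2_nrm (s + v N) ^+ 2) (l2_nrm s ^+ 2 + l2_nrm (v N) ^+ 2).
    by exists 1; rewrite ?cmod1 ?scale1r.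
  exists (-1); first by rewrite cmodN cmod1.
  rewrite scaleN1r; lra.
exists (fun k => if k == N then e else eps k); split.
  by move=> k; case: ifP.
rewrite !big_nat_recr //= eqxx.
rewrite [X in l2_nrm (X + _)](_ : _ = s); last first.
  rewrite /s big_nat [RHS]big_nat; apply: eq_bigr => k /andP[_ kN].
  by rewrite ltn_eqF.
by apply: le_trans he _; rewrite lerD2r.
Qed.

End Hilbert.

Section BlockMap.
Variable R : realType.
Local Notation C := R[i].
Local Notation V := (omega R * omega R)%type.
Local Notation NZ := (Z_nrm (S2 R)).
Variables (n : nat) (w : nat -> omega R).

Definition block_map (a : 'rV[C]_n) : V := \sum_(k < n) a 0 k *: vert (w k).

Fact block_map_linear : linear block_map.
Proof.
move=> k a b; rewrite /block_map scaler_sumr -big_split /=.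
by apply: eq_bigr => i _; rewrite !mxE scalerDl scalerA.
Qed.

HB.instance Definition _ :=
  GRing.isLinear.Build C 'rV[C]_n V _ block_map block_map_linear.

Lemma block_map_delta (k : 'I_n) : block_map (delta_mx 0 k) = vert (w k).
Proof.
rewrite /block_map (bigD1 k) //= mxE !eqxx scale1r big1 ?addr0 // => i /negPf ik.
by rewrite mxE ik andbF scale0r.
Qed.

Variable M : nat -> nat.
Hypothesis Hw : spread_blocks n M w.

Lemma block_map_inj : injective block_map.
Proof.
apply: raddf_inj => a a0; apply/rowP => k; rewrite mxE.
have [j jk wj] : exists2 j, (M k <= j < (M k).*2.+1)%N & w k j != 0.
  apply: contrapT => h; have := spread_unit Hw k.
  rewrite big_nat big1 ?(oner_eq0, negbT) => [/eqP|j jk].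
    by rewrite eq_sym oner_eq0.
  have -> : w k j = 0 by apply/eqP/negPn/negP => wj; apply: h; exists j.
  by rewrite cmod0 expr0n.
have := congr1 (fun v : V => v.2 j) a0; rewrite /block_map /=.
have -> : (\sum_(k < n) a 0 k *: vert (w k)).2 j = \sum_(k < n) a 0 k * w k j.
  by elim/big_rec2: _ => //= i x v _ <-.
rewrite (bigD1 k) //= big1 ?addr0 => [/eqP|i ik].
  by rewrite mulf_eq0 (negPf wj) orbF => /eqP.
rewrite (spread_supported Hw) ?mulr0 //; apply: contra ik => ij.
by apply/eqP/val_inj; exact: (blocks_disjoint Hw ij jk).
Qed.

Hypothesis n0 : (0 < n)%N.

Lemma vert_block_le1 k : (NZ (vert (w k)) <= 1)%E.
Proof.
apply: (Z_nrm_block_le1 (M := M k)); first exact: (spread_supported Hw).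
by rewrite (spread_unit Hw).
Qed.

Let beta : R := (ln n%:R - 2) / 8.
Hypothesis beta0 : 0 < beta.

(** Let T be an isomorphism and let v k be the preimages of the blocks, of norm
    at most q, the norm of the inverse of T. For suitable signs the sum of the n
    vectors v k has norm at most sqrt n * q, while its image has norm at least
    beta * sqrt n. Hence the norm of T is at least beta / q. *)
Lemma BM_dist_block_map_ge : (beta%:E <= BM_dist_l2 NZ n (range block_map))%E.
Proof.
apply: le_ereal_inf_tmp => _ [T [Tinj Tr] <-].
have /choice[v vP] : forall k, exists a : 'rV[C]_n, (k < n)%N -> T a = vert (w k).
  move=> k; have [kn|nk] := ltnP k n; last by exists 0.
  have : range T (vert (w k)).
    by rewrite Tr; exists (delta_mx 0 (Ordinal kn)) => //; exact: block_map_delta.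
  by move=> [a _ Ta]; exists a.
have vq k : (k < n)%N -> ((l2_nrm (v k))%:E <= op_inv_nrm NZ T)%E.
  move=> kn; apply: ereal_sup_ubound; exists (v k) => //=.
  by rewrite vP //; exact: vert_block_le1.
have v0 : v 0%N != 0.
  apply/eqP => v0; have := vP _ n0; rewrite v0 linear0.
  rewrite -[0%N]/(val (Ordinal n0)) -block_map_delta -[LHS](linear0 block_map).
  move/block_map_inj => /rowP/(_ (Ordinal n0)); rewrite !mxE !eqxx => /eqP.
  by rewrite eq_sym oner_eq0.
have nr : 0 < n%:R :> R by rewrite ltr0n.
have key (Q : R) : 0 < Q -> (forall k, (k < n)%N -> l2_nrm (v k) <= Q) ->
    ((beta / Q)%:E <= op_nrm NZ T)%E.
  move=> Q0 vQ; have [eps [eps1 he]] := signs_l2_nrm_le v n.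
  set b := \sum_(0 <= k < n) _ in he.
  have s0 : 0 < Num.sqrt n%:R :> R by rewrite sqrtr_gt0.
  have bQ : l2_nrm b <= Num.sqrt n%:R * Q.
    rewrite -(ler_pXn2r (n := 2)) ?nnegrE ?l2_nrm_ge0 ?mulr_ge0 ?(ltW s0) ?(ltW Q0) //.
    apply: le_trans he _; rewrite exprMn sqr_sqrtr ?(ltW nr) //.
    rewrite -[n in leRHS]subn0 mulr_natl -sumr_const_nat big_nat [leRHS]big_nat.
    apply: ler_sum => k /andP[_ kn].
    by rewrite lerXn2r ?nnegrE ?l2_nrm_ge0 ?(ltW Q0) // vQ.
  pose c := (Num.sqrt n%:R * Q)^-1.
  have c0 : 0 < c by rewrite invr_gt0 mulr_gt0.
  have Tb : T (c%:C *: b) = vert (fun j => c%:C * signed_sum n w eps j).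
    rewrite linearZ_LR linear_sum /=.
    under eq_big_nat => k /andP[_ kn] do rewrite linearZ_LR vP //.
    rewrite -[RHS]/(vert (c%:C *: signed_sum n w eps)) vertZ; congr (_ *: _).
    by rewrite -vert_sum; congr vert; apply/funext => j; rewrite fct_sumE.
  apply: le_trans (_ : (NZ (T (c%:C *: b)) <= _)%E).
    rewrite Tb; apply: le_trans (Z_nrm_signed_sum_ge n0 Hw eps1 c0).
    rewrite lee_fin /beta /c le_eqVlt; apply/orP; left; apply/eqP; field.
    by rewrite !gt_eqF.
  apply: ereal_sup_ubound; exists (c%:C *: b) => //=.
  by rewrite l2_nrmZ cmod_real gtr0_norm // /c mulrC ler_pdivrMr ?mul1r // mulr_gt0.
have q0 := lt_le_trans (_ : (0 < (l2_nrm (v 0%N))%:E)%E) (vq _ n0).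
rewrite lte_fin l2_nrm_gt0 // in q0; have {}q0 := q0 isT.
move: (op_inv_nrm NZ T) q0 vq => [q| |] // q0 vq.
  rewrite lte_fin in q0.
  have h := key q q0 (fun k kn => vq k kn).
  apply: le_trans (_ : ((beta / q)%:E * q%:E <= _)%E).
    by rewrite -EFinM divfK // gt_eqF.
  by rewrite lee_wpmul2r // lee_fin ltW.
(* T^-1 is unbounded; the product is +oo because T has a positive norm. *)
have : (0 < op_nrm NZ T)%E.
  pose Q := 1 + \sum_(0 <= k < n) l2_nrm (v k).
  have Q0 : 0 < Q by rewrite ltr_pwDl // sumr_ge0 // => k _; exact: l2_nrm_ge0.
  apply: lt_le_trans (key Q Q0 _); first by rewrite lte_fin divr_gt0.
  move=> k kn; rewrite /Q (bigD1_seq k) ?iota_uniq ?mem_index_iota //=.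
  rewrite addrCA lerDl addr_ge0 // sumr_ge0 // => i _; exact: l2_nrm_ge0.
by move=> /gt0_muley ->; rewrite leey.
Qed.

End BlockMap.

Theorem proposition3 (R : realType) :
  ~ @asymptotically_hilbertian R (omega R * omega R)%type (Z_nrm (S2 R)).
Proof.
move=> [K K0 hK].
pose n := Num.bound (expR (8 * K + 2)).
have en : expR (8 * K + 2) < n%:R by apply: archi_boundP; exact: expR_ge0.
have nr : 0 < n%:R :> R by apply: lt_trans en; exact: expR_gt0.
have n0 : (0 < n)%N by rewrite -(ltr0n R).
have lnn : 8 * K + 2 < ln n%:R by rewrite -ltr_expR lnK ?posrE.
have [X [Xsub _ [m [s [_ Xcodim]]] hX]] := hK n.
have [M [w [Hw Xw]]] := subspace_spread_blocks Xsub Xcodim n0.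
have EX : range (@block_map R n w) `<=` X.
  by move=> _ [a _ <-]; apply: subspace_sum.
have dimE : has_dim n (range (@block_map R n w)).
  by exists (@block_map R n w); split => //; exact: block_map_inj Hw.
have := hX _ EX dimE; apply/negP; rewrite -ltNge.
have beta0 : 0 < (ln n%:R - 2) / 8 :> R by lra.
apply: lt_le_trans (BM_dist_block_map_ge Hw n0 beta0).
by rewrite lte_fin; lra.
Qed.
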